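(* Let $k\ge1$ be an integer and $L\in\mathbb{N}$. Let $(X,\mathbb{Z}^k)$ be an extension of an irrational $\mathbb{Z}^k$-rotation on the $k$-torus, with $\operatorname{mdim}(X)<L/2$. Then there exists an embedding from $(X,\mathbb{Z}^k)$ into $\bigl(([0,1]^{2^kL+1})^{\mathbb{Z}^k},\sigma\bigr)$.
   Context: $\mathbb{N}=\{1,2,\dots\}$. A $\mathbb{Z}^k$-action $(X,\mathbb{Z}^k)$ is a continuous action of $\mathbb{Z}^k$ on a compact metric space $X$, written $(g,x)\mapsto gx$. $(X,\mathbb{Z}^k)$ is an extension of $(Y,\mathbb{Z}^k)$ if there is a continuous surjective equivariant map $X\to Y$. An embedding of $\mathbb{Z}^k$-actions is a continuous injective equivariant map. An irrational $\mathbb{Z}^k$-rotation on the $k$-torus $\mathbb{T}^k=(\mathbb{R}/\mathbb{Z})^k$ is the action in which $(n_1,\dots,n_k)\in\mathbb{Z}^k$ sends $(x_1,\dots,x_k)$ to $(x_1+n_1\alpha_1,\dots,x_k+n_k\alpha_k)$, where $\alpha_1,\dots,\alpha_k$ are irrational numbers (not necessarily linearly independent over the rationals). Shift: for $N\in\mathbb{N}$, $\sigma$ is the action of $\mathbb{Z}^k$ on $([0,1]^N)^{\mathbb{Z}^k}$ (product topology) where $m\in\mathbb{Z}^k$ sends $(x_n)_n$ to $(x_{n+m})_n$. Mean dimension: for a compact metric space $(X,d)$ and $\epsilon>0$, $\operatorname{widim}_\epsilon(X,d)$ is the smallest integer $n$ such that $X$ has a finite open cover $\mathcal{U}$ all of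 whose members have diameter at most $\epsilon$ and whose order $-1+\max_{x}\#\{U\in\mathcal{U}:x\in U\}$ is $n$. With $[n]=\{0,\dots,n-1\}^k$ and $d_{[n]}(x,y)=\max_{g\in[n]}d(gx,gy)$, where $d$ is the metric of $X$, $$\operatorname{mdim}(X)=\sup_{\epsilon>0}\lim_{n\to\infty}\frac{\operatorname{widim}_\epsilon(X,d_{[n]})}{n^k}$$ (the limit exists). *)

(* Defs.v *)
From HB Require Import structures.
From mathcomp Require Import all_boot all_order all_algebra finmap.
From mathcomp Require Import generic_quotient ring_quotient.
From mathcomp Require Import all_classical all_reals all_analysis.
Import Order.TTheory GRing.Theory Num.Theory.
Import numFieldTopology.Exports.

Set Implicit Arguments.
Unset Strict Implicit.
Unset Printing Implicit Defensive.

Local Open Scope classical_set_scope.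
Local Open Scope ring_scope.
Local Open Scope quotient_scope.

Record Zk_action (k : nat) (X : topologicalType) := ZkAction {
  act :> 'rV[int]_k -> X -> X;
  act0 : forall x, act 0 x = x;
  actD : forall g h x, act (g + h) x = act g (act h x);
  act_continuous : forall g, continuous (act g) }.

Definition equivariant (k : nat) (X Y : topologicalType)
    (S : Zk_action k X) (T : Zk_action k Y) (f : X -> Y) : Prop :=
  forall g x, f (S g x) = T g (f x).

Definition is_extension (k : nat) (X Y : topologicalType)
    (S : Zk_action k X) (T : Zk_action k Y) : Prop :=
  exists f : X -> Y,
    [/\ continuous f, set_surj [set: X] [set: Y] f & equivariant S T f].

Definition embeds (k : nat) (X Y : topologicalType)
    (S : Zk_action k X) (T : Zk_action k Y) : Prop :=
  exists f : X -> Y, [/\ continuous f, injective f & equivariant S T f].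

Lemma ptws_continuous (I : eqType) (X Y : topologicalType)
    (f : X -> {ptws I -> Y}) :
  (forall i, continuous (fun x => f x i)) -> continuous f.
Proof.
move=> cf x; apply/cvg_sup => i U [_ [[V oV <-] Vfx VU]].
apply: filterS VU _; apply: (cf i x); exact: open_nbhs_nbhs.
Qed.

Lemma ptws_proj_continuous (I : eqType) (Y : topologicalType) (i : I) :
  continuous (fun x : {ptws I -> Y} => x i).
Proof. exact: (@proj_continuous I (fun=> Y) i). Qed.

Section rotation.
Variable R : realType.

Definition integers : {pred R} := fun x => x \is a Num.int.

Fact integers_zmod_closed : zmod_closed integers.
Proof. by split=> [|x y]; [exact: rpred0 | exact: rpredB]. Qed.

HB.instance Definition _ :=
  GRing.isZmodClosed.Build R integers integers_zmod_closed.

(* R / Z, with the quotient topology and the quotient group law *)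
Definition circle : Type := quotient_topology (Quotient.quot integers).

HB.instance Definition _ := Quotient.on circle.
HB.instance Definition _ := Topological.on circle.
HB.instance Definition _ := GRing.isZmodule.Build circle
  (@Quotient.addqA R integers) (@Quotient.addqC R integers)
  (@Quotient.add0q R integers) (@Quotient.addNq R integers).

Lemma pi_circleD (x y : R) :
  \pi_circle (x + y) = \pi_circle x + \pi_circle y.
Proof. exact: (Quotient.pi_add integers x y). Qed.

Lemma pi_circle_eq (x y : R) :
  \pi_circle x = \pi_circle y <-> x - y \is a Num.int.
Proof.
rewrite -(rwP (@idP (x - y \in integers))).
by rewrite (Quotient.idealrBE integers) -(rwP eqP).
Qed.

Lemma circle_translation_continuous (a : circle) :
  continuous (fun x : circle => x + a).
Proof.
rewrite -[a]reprK; apply/quotient_continuous.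
rewrite [X in continuous X](_ : _ = \pi_circle \o (fun x => x + repr a)).
  move=> x; apply: continuous_comp; last exact: pi_continuous.
  by apply: cvgD; [exact: cvg_id | exact: cvg_cst].
by apply/funext => x /=; rewrite pi_circleD.
Qed.

Variables (k : nat) (alpha : 'I_k -> R).

Definition torus : Type := {ptws 'I_k -> circle}.
HB.instance Definition _ := Topological.on torus.

Definition rotation_fun (n : 'rV[int]_k) (x : torus) : torus :=
  fun i => x i + \pi_circle ((n ord0 i)%:~R * alpha i).

Fact rotation_fun0 x : rotation_fun 0 x = x.
Proof.
apply/funext => i; rewrite /rotation_fun mxE mul0r.
by rewrite -[x i]reprK -pi_circleD addr0.
Qed.

Fact rotation_funD g h x :
  rotation_fun (g + h) x = rotation_fun g (rotation_fun h x).
Proof.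
apply/funext => i; rewrite /rotation_fun mxE intrD mulrDl.
by rewrite pi_circleD [X in _ + X]addrC addrA.
Qed.

Fact rotation_fun_continuous g : continuous (rotation_fun g).
Proof.
apply: ptws_continuous => i x.
apply: (@continuous_comp _ _ _ (fun x : torus => x i)
  (fun y : circle => y + \pi_circle ((g ord0 i)%:~R * alpha i))).
  exact: ptws_proj_continuous.
exact: circle_translation_continuous.
Qed.

Definition rotation : Zk_action k torus :=
  ZkAction rotation_fun0 rotation_funD rotation_fun_continuous.

End rotation.

Section shift.
Variables (R : realType) (k N : nat).

Definition cube : Type := {ptws 'I_N -> `[0 : R, 1]%classic}.
HB.instance Definition _ := Topological.on cube.

Definition full_shift_space : Type := {ptws 'rV[int]_k -> cube}.
HB.instance Definition _ := Topological.on full_shift_space.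

Definition shift_fun (m : 'rV[int]_k) (x : full_shift_space) :
  full_shift_space := fun n => x (n + m).

Fact shift_fun0 x : shift_fun 0 x = x.
Proof. by apply/funext => n; rewrite /shift_fun addr0. Qed.

Fact shift_funD g h x : shift_fun (g + h) x = shift_fun g (shift_fun h x).
Proof. by apply/funext => n; rewrite /shift_fun addrA. Qed.

Fact shift_fun_continuous g : continuous (shift_fun g).
Proof. by apply: ptws_continuous => n; exact: ptws_proj_continuous. Qed.

Definition full_shift : Zk_action k full_shift_space :=
  ZkAction shift_fun0 shift_funD shift_fun_continuous.

End shift.

Section mean_dimension.
Variable R : realType.

Definition multiplicity (X : Type) (U : set (set X)) (x : X) : nat :=
  #|` fset_set [set A | U A /\ A x]|.

(* n = -1 + max_x (multiplicity U x), for a finite cover U of a nonempty X *)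
Definition has_order (X : Type) (U : set (set X)) (n : nat) : Prop :=
  (forall x, (multiplicity U x <= n.+1)%N) /\
  (exists x, multiplicity U x = n.+1).

Definition has_eps_cover_of_order (X : topologicalType) (d : X -> X -> R)
    (eps : R) (n : nat) : Prop :=
  exists U : set (set X),
    [/\ finite_set U,
        (forall A, U A -> open A),
        \bigcup_(A in U) A = [set: X],
        (forall A, U A -> forall x y, A x -> A y -> d x y <= eps)
      & has_order U n].

(* The default value 0 is only used if no cover as above exists. *)
Definition widim (X : topologicalType) (d : X -> X -> R) (eps : R) : nat :=
  xget 0%N [set n | has_eps_cover_of_order d eps n /\
    forall m, has_eps_cover_of_order d eps m -> (n <= m)%N].

Variables (k : nat) (X : metricType R) (T : Zk_action k X).

Definition dyn_dist (n : nat) (x y : X) : R :=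
  \big[Num.max/0]_(g : {ffun 'I_k -> 'I_n})
    mdist (T (\row_i (g i)%:Z) x) (T (\row_i (g i)%:Z) y).

Definition mdim : \bar R :=
  ereal_sup
    [set (limn (fun n => (widim (dyn_dist n) eps)%:R / (n ^ k)%:R : R))%:E
    | eps in [set eps | 0 < eps]].

End mean_dimension.

(* Main.v *)
From HB Require Import structures.
Require Import Defs.
From mathcomp Require Import all_boot all_order all_algebra finmap.
From mathcomp Require Import all_classical all_reals all_analysis.
From mathcomp Require Import ring lra zify.
Import Order.TTheory GRing.Theory Num.Theory.
Import numFieldNormedType.Exports.

Set Implicit Arguments.
Unset Strict Implicit.
Unset Printing Implicit Defensive.

Local Open Scope classical_set_scope.
Local Open Scope ring_scope.

(** The orbit of a point x is recorded by functions f with values in [0, 1],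
    and the factor map p onto the torus is used twice.

    Along the fibres of p.  If mdim < L/2, then for every eps and every large
    box H of Z^k there is an open cover of X, small along the orbit pieces
    indexed by H, of order m with 2m + 1 <= L |H| (mdim_lt_box).  Any
    continuous map into the cube of dimension L |H| can be moved slightly so
    that the nerve of this cover is embedded in general position (nerve_map).
    Applied to x |-> (f (h x))_(h in H), this gives a map F, close to the
    orbit of f, whose value at z determines the piece (h z)_(h in H) up to
    eps.  To turn F into the orbit of a single perturbed function, one needs
    to know where along its orbit a point is, and this is read from the torus.
    For an irrational rotation of the circle, the gaps of the set
    {h a : 0 <= h < N} are less than twice the smallest gap when N is a record
    return time, so two arcs suffice: each has N disjoint translates, and
    these 2N translates cover the circle (circle_towers).  Products give 2^k
    towers on the torus, indexed by boxes (torus_towers).  With one group of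
    L coordinates for each tower, f is replaced on the level h of the tower
    by the coordinate h of F (perturb).  Then points of one fibre with the
    same f-orbit are eps-close, and this remains true for all functions
    sufficiently near to the new f.  Iterating with eps = 1/n and passing to
    the limit makes f separate the points of every fibre (separating_limit),
    with 2^k L coordinates.

    Across the fibres.  One more function is enough: the mean over i of the
    distances from the coordinates of p x to 0.  Since k independent integers
    act on the k coordinates, some translate brings all coordinates of p x
    near 0, and then the coordinates of p y are near 0 only if p x = p y
    (torus_height_separates).

    The definition of mdim takes a limit, and its existence has to be proved:
    the widim of a union of translates of a box is at most the sum of the
    widims (join_translates), and Fekete's argument applies
    (box_subadditive_cvg).  The same inequality passes from cubes to the boxes
    of unequal sides that the towers impose. *)

(** * Distance to the nearest integer and towers of circle rotations *)

Section distance_to_integers.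
Variable R : realType.
Implicit Types s t : R.

Definition int_dist t : R :=
  Num.min (t - (Num.floor t)%:~R) (1 - (t - (Num.floor t)%:~R)).

Lemma int_dist_le t (n : int) : int_dist t <= `|t - n%:~R|.
Proof.
have /andP[] := floor_itv t; rewrite intrD /int_dist => f1 f2.
have [nf|nf] := lerP n (Num.floor t).
  rewrite ge_min; apply/orP; left.
  have : (n%:~R : R) <= (Num.floor t)%:~R by rewrite ler_int.
  move=> ?; apply: le_trans (ler_norm _); lra.
have : ((Num.floor t + 1)%:~R : R) <= n%:~R by rewrite ler_int lezD1.
rewrite intrD => ?; rewrite ge_min; apply/orP; right.
rewrite distrC; apply: le_trans (ler_norm _); lra.
Qed.

Lemma int_dist_ex t : exists n : int, int_dist t = `|t - n%:~R|.
Proof.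
have /andP[] := floor_itv t; rewrite intrD /int_dist => f1 f2.
case: leP => _.
  by exists (Num.floor t); rewrite ger0_norm //; lra.
exists (Num.floor t + 1); rewrite intrD distrC ger0_norm; lra.
Qed.

Lemma int_dist_ge0 t : 0 <= int_dist t.
Proof. by have [n ->] := int_dist_ex t. Qed.

Lemma int_dist_le1 t : int_dist t <= 1.
Proof.
have /andP[] := floor_itv t; rewrite intrD /int_dist => f1 f2.
by rewrite ge_min; apply/orP; left; lra.
Qed.

Lemma int_distDz t (n : int) : int_dist (t + n%:~R) = int_dist t.
Proof.
apply/eqP; rewrite eq_le; apply/andP; split.
  have [m ->] := int_dist_ex t; apply: le_trans (int_dist_le _ (m + n)) _.
  by rewrite intrD opprD addrACA subrr addr0.
have [m ->] := int_dist_ex (t + n%:~R).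
apply: le_trans (int_dist_le _ (m - n)) _.
by rewrite intrB opprB addrA addrAC.
Qed.

Lemma int_distN t : int_dist (- t) = int_dist t.
Proof.
wlog suff le : t / int_dist (- t) <= int_dist t.
  by apply/eqP; rewrite eq_le le -{1}[t]opprK le.
have [m ->] := int_dist_ex t; apply: le_trans (int_dist_le _ (- m)) _.
by rewrite intrN opprK addrC distrC.
Qed.

Lemma int_dist_lip s t : int_dist s <= `|s - t| + int_dist t.
Proof.
have [m ->] := int_dist_ex t; apply: le_trans (int_dist_le _ m) _.
by have := ler_normD (s - t) (t - m%:~R); rewrite addrA subrK.
Qed.

Lemma int_distB s t : int_dist (s - t) <= int_dist s + int_dist t.
Proof.
have [m ->] := int_dist_ex s; have [n ->] := int_dist_ex t.
apply: le_trans (int_dist_le _ (m - n)) _.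
rewrite intrB [leLHS](_ : _ = `|(s - m%:~R) - (t - n%:~R)|) ?ler_normB//.
by congr `|_|; ring.
Qed.

Lemma int_dist_eq0 t : int_dist t = 0 -> t \is a Num.int.
Proof.
have [n ->] := int_dist_ex t => /normr0_eq0/eqP; rewrite subr_eq0 => /eqP ->.
exact: intr_int.
Qed.

Lemma int_dist_continuous : continuous int_dist.
Proof.
move=> t; apply/cvgrPdist_lt => e e0; near=> s.
have st : `|t - s| < e by near: s; exact: cvgr_dist_lt.
have h1 := int_dist_lip t s; have := int_dist_lip s t; rewrite distrC => h2.
by rewrite ltr_norml; apply/andP; split; lra.
Unshelve. all: by end_near. Qed.

Lemma int_dist_mul_gt0 (a : R) (h : nat) :
  irrational a -> (0 < h)%N -> 0 < int_dist (h%:R * a).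
Proof.
move=> ira h0; rewrite lt_neqAle int_dist_ge0 andbT eq_sym; apply/eqP.
move=> /int_dist_eq0 /intrP[m hm]; apply: ira; exists (m%:~R / h%:R) => //.
rewrite rmorphM /= fmorphV /= ratr_int ratr_nat -hm mulrC mulKf //.
by rewrite pnatr_eq0 -lt0n.
Qed.

(** Pigeonhole: among K + 1 fractional parts of multiples of a, two lie in the
    same interval of length 1/K. *)
Lemma int_dist_small (a mu : R) : 0 < mu ->
  exists2 n, (0 < n)%N & int_dist (n%:R * a) < mu.
Proof.
move=> mu0; pose K := (Num.bound mu^-1).
have K0 : 0 < (K%:R : R).
  by apply: lt_trans (archi_boundP _); rewrite ?invr_gt0 // ltW // invr_gt0.
have Kmu : (K%:R : R)^-1 < mu.
  rewrite -[mu]invrK ltf_pV2 ?posrE ?invr_gt0 //; apply: archi_boundP.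
  by rewrite ltW // invr_gt0.
pose u (h : nat) : R := h%:R * a - (Num.floor (h%:R * a))%:~R.
have u01 h : 0 <= u h < 1.
  have /andP[] := floor_itv (h%:R * a); rewrite intrD /u => ? ?.
  by apply/andP; split; lra.
have K0n : (0 < K)%N by rewrite -(ltr0n R).
have bnd h : (Num.truncn (u h * K%:R) < K)%N.
  have /andP[u0 u1] := u01 h.
  rewrite truncn_lt_nat; first by rewrite gtr_pMl.
  by rewrite mulr_ge0 // ltW.
pose bin (h : 'I_K.+1) : 'I_K := Ordinal (bnd h).
have /injectivePn[h [h' hh' ebin]] : ~~ injectiveb bin.
  apply/negP => /injectiveP /leq_card; rewrite !card_ord.
  by rewrite ltnn.
wlog lth : h h' hh' ebin / (h < h')%N.
  move=> W; case: (ltngtP h h') => [/W|/W|/val_inj e]; [exact| | ].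
    by apply; rewrite // eq_sym.
  by rewrite e eqxx in hh'.
exists (h' - h)%N; first by rewrite subn_gt0.
apply: le_lt_trans Kmu.
have := congr1 val ebin => /= eb.
have /andP[v0 v1] := u01 h; have /andP[v0' v1'] := u01 h'.
have := truncn_itv (mulr_ge0 v0 (ltW K0)).
have := truncn_itv (mulr_ge0 v0' (ltW K0)).
rewrite eb -[X in _ < X]natr1 => /andP[A1 A2]; rewrite -natr1 => /andP[B1 B2].
rewrite natrB ?(ltnW lth) // mulrBl.
apply: le_trans (int_dist_le _ (Num.floor (h'%:R * a) - Num.floor (h%:R * a))) _.
rewrite intrB [X in `|X|](_ : _ = u h' - u h); last by rewrite /u; ring.
rewrite -(ler_pM2r K0) mulVf ?lt0r_neq0 // -{1}(gtr0_norm K0) -normrM mulrBl.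
by rewrite ler_norml; apply/andP; split; lra.
Qed.

(** N is a record: no earlier multiple of a is as close to an integer.  The
    first return below the minimum over h <= M + 1 is such an N.  The index j
    realises the smallest gap of {h a : 0 <= h < N}. *)
Lemma record_returns (a : R) (M : nat) : irrational a ->
  exists N j, [/\ (M < N)%N, (0 < j < N)%N,
    forall h, (0 < h < N)%N -> int_dist (j%:R * a) <= int_dist (h%:R * a)
    & 0 < int_dist (N%:R * a) < int_dist (j%:R * a)].
Proof.
move=> ira.
(* The bound M.+1 rather than M makes N >= 2, so that some 0 < j < N exists. *)
have [mu mu0 muP] : exists2 mu : R, 0 < mu &
    forall h, (0 < h <= M.+1)%N -> mu <= int_dist (h%:R * a).
  elim: M.+1 => [|{}M [mu mu0 muP]].
    by exists 1 => // h; case: h.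
  exists (Num.min mu (int_dist (M.+1%:R * a))).
    by rewrite lt_min mu0 int_dist_mul_gt0.
  move=> h /andP[h0]; rewrite leq_eqVlt => /orP[/eqP ->|hM].
    by rewrite ge_min lexx orbT.
  by rewrite ge_min muP // h0.
have [n n0 nmu] := int_dist_small a mu0.
have ex : exists n, (0 < n)%N && (int_dist (n%:R * a) < mu).
  by exists n; rewrite n0.
case: (ex_minnP ex) => N /andP[N0 Nmu] Nmin.
have rec h : (0 < h < N)%N -> int_dist (N%:R * a) < int_dist (h%:R * a).
  move=> /andP[h0 hN]; apply: lt_le_trans Nmu _; rewrite leNgt; apply/negP => hmu.
  by have := Nmin h; rewrite h0 hmu leqNgt hN => /(_ isT).
have MN : (M.+1 < N)%N.
  rewrite ltnNge; apply/negP => NM.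
  by have := muP N; rewrite N0 NM leNgt Nmu => /(_ isT).
have N1 : (1 < N)%N by lia.
pose j := [arg min_(i < Ordinal N1 | (0 < i)%N) int_dist (i%:R * a)]%O.
have [j0 jmin] : (0 < j)%N /\ forall h, (0 < h < N)%N ->
    int_dist (j%:R * a) <= int_dist (h%:R * a).
  rewrite /j; case: arg_minP => //= i i0 imin; split=> // h /andP[h0 hN].
  exact: (imin (Ordinal hN)).
have jN : (0 < j < N)%N by rewrite j0 /=.
exists N, j; split=> //; first exact: ltnW.
by rewrite int_dist_mul_gt0 // rec.
Qed.

(** Write d = |N a| and d' = |j a| modulo the integers.  At a record, j a and
    N a lie on opposite sides of 0, since otherwise (N - j) a would be closer
    to 0 than j a.  From h a, adding j a (if h + j < N) or j a - N a (if not)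
    leads to another point h' a with h' < N, further by d' or d + d' in a
    fixed direction.  So gaps are at most d + d', and every point is within
    half of this of one of the h a. *)
Lemma record_cover (a : R) (N j : nat) :
    (0 < j < N)%N ->
    (forall h, (0 < h < N)%N -> int_dist (j%:R * a) <= int_dist (h%:R * a)) ->
    0 < int_dist (N%:R * a) < int_dist (j%:R * a) ->
  forall y, exists2 h, (h < N)%N & int_dist (y - h%:R * a) <=
    (int_dist (N%:R * a) + int_dist (j%:R * a)) / 2.
Proof.
move=> jN jmin dd' y.
have [p pE] := int_dist_ex (j%:R * a).
wlog jp : a y p jmin dd' pE / 0 <= j%:R * a - p%:~R.
  move=> W; have [|jp] := lerP 0 (j%:R * a - p%:~R); first exact: W pE.
  have eqN (n : nat) : int_dist (n%:R * (- a)) = int_dist (n%:R * a).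
    by rewrite mulrN int_distN.
  have [||||h hN hy] := W (- a) (- y) (- p).
  - by move=> h /jmin; rewrite !eqN.
  - by rewrite !eqN.
  - by rewrite eqN pE mulrN intrN -opprD normrN.
  - by rewrite mulrN intrN -opprD oppr_ge0 ltW.
  exists h => //; move: hy; rewrite !eqN mulrN -opprD int_distN.
  by [].
have [q qE] := int_dist_ex (N%:R * a).
rewrite ger0_norm // in pE.
(* From here on, adding j a moves to the right by d'. *)
set d' := int_dist (j%:R * a) in jmin dd' pE *.
set d := int_dist (N%:R * a) in dd' qE *.
case/andP: jN => j0 jN; case/andP: dd' => d0 dd'.
have qE' : N%:R * a - q%:~R = - d.
  case: (lerP 0 (N%:R * a - q%:~R)) qE => [/[dup] ? /ger0_norm ->|/ltr0_norm ->] qE;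
    last by rewrite qE opprK.
  have /jmin : (0 < N - j < N)%N by lia.
  rewrite leNgt => /negP; case.
  apply: le_lt_trans (int_dist_le _ (q - p)) _.
  rewrite natrB ?(ltnW jN) // intrB [X in `|X|](_ : _ = d - d').
    by rewrite ler0_norm; lra.
  by rewrite qE pE; ring.
(* u h is how far y is to the right of h a; h is the nearest point to its
   left, so a step to the right that lands before y contradicts the choice
   of h. *)
pose u (h : nat) : R := y - h%:R * a - (Num.floor (y - h%:R * a))%:~R.
have u01 h : 0 <= u h < 1.
  have /andP[] := floor_itv (y - h%:R * a); rewrite intrD /u => ? ?.
  by apply/andP; split; lra.
have N0 : (0 < N)%N by exact: leq_ltn_trans jN.
pose i0 : 'I_N := Ordinal N0.
pose h := [arg min_(i < i0) u i]%O.
have hmin (i : 'I_N) : u h <= u i by rewrite /h; case: arg_minP => // ? _; apply.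
have /andP[uh0 uh1] := u01 h.
have step (i : 'I_N) (e : R) (m : int) : 0 < e ->
    y - i%:R * a = y - h%:R * a - e - m%:~R -> u h < e.
  move=> e0 ei; rewrite ltNge; apply/negP => eu; have := hmin i.
  suff -> : u i = u h - e by lra.
  rewrite {1}/u (_ : Num.floor _ = Num.floor (y - h%:R * a) - m).
    by rewrite ei intrB /u; ring.
  apply: floor_def; rewrite ei !(intrD, intrN); move: uh0 uh1 eu; rewrite /u => *.
  by apply/andP; split; lra.
have close (i : 'I_N) (e : R) (m : int) : u h < e -> e <= d + d' ->
    y - i%:R * a = y - h%:R * a - e - m%:~R ->
    exists2 h, (h < N)%N & int_dist (y - h%:R * a) <= (d + d') / 2.
  move=> ue ed ei; have [small|big] := lerP (u h) ((d + d') / 2).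
    exists h => //; apply: le_trans (int_dist_le _ (Num.floor (y - h%:R * a))) _.
    by rewrite ger0_norm.
  exists i => //.
  apply: le_trans (int_dist_le _ (Num.floor (y - h%:R * a) - m)) _.
  rewrite ei intrB [X in `|X|](_ : _ = u h - e); last by rewrite /u; ring.
  by rewrite ltr0_norm; lra.
have [hjN|hjN] := ltnP (h + j) N.
  have e : y - (h + j)%:R * a = y - h%:R * a - d' - p%:~R.
    by rewrite natrD pE; ring.
  apply: (close (Ordinal hjN) d' p) => //; last by lra.
  by apply: (step (Ordinal hjN) d' p) => //; lra.
have hj : (h + j - N < N)%N by have := ltn_ord h; lia.
have e : y - (h + j - N)%N%:R * a = y - h%:R * a - (d + d') - (p - q)%:~R.
  have dE : d = - (N%:R * a - q%:~R) by rewrite qE' opprK.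
  by rewrite natrB // natrD intrB pE dE; ring.
apply: (close (Ordinal hj) (d + d') (p - q)) => //.
by apply: (step (Ordinal hj) (d + d') (p - q)) => //; lra.
Qed.

(** The negative multiples of a are already dense, because the gaps at a record
    N are at most twice the smallest gap, which tends to 0. *)
Lemma orbit_dense (a t e : R) : irrational a -> 0 < e ->
  exists n : int, int_dist (t + n%:~R * a) < e.
Proof.
move=> ira e0; have [n0 n00 n0e] := int_dist_small a e0.
have [N [j [nN jN jmin dd']]] := record_returns n0 ira.
have [h _ ht] := record_cover jN jmin dd' t.
exists (- h%:Z); rewrite mulrNz mulNr; apply: le_lt_trans ht _.
have : int_dist (j%:R * a) <= int_dist (n0%:R * a) by rewrite jmin // n00.
by case/andP: dd'; lra.
Qed.

Definition ramp (lo hi s : R) : R :=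
  Num.max 0 (Num.min 1 ((hi - s) / (hi - lo))).

Lemma ramp_itv lo hi s : 0 <= ramp lo hi s <= 1.
Proof. by rewrite /ramp le_max lexx /= ge_max ler01 /= ge_min lexx. Qed.

Lemma ramp1 lo hi s : lo < hi -> s <= lo -> ramp lo hi s = 1.
Proof.
move=> lh sl; rewrite /ramp min_l ?max_r // ler_pdivlMr ?mul1r; lra.
Qed.

Lemma ramp_neq0 lo hi s : lo < hi -> ramp lo hi s != 0 -> s < hi.
Proof.
move=> lh; rewrite ltNge; apply: contra => hs; rewrite /ramp max_l //.
rewrite ge_min; apply/orP; right; rewrite pmulr_lle0 ?invr_gt0; lra.
Qed.

Lemma ramp_continuous lo hi : continuous (ramp lo hi).
Proof.
move=> s.
apply: (@continuous_max R R (fun=> 0) (fun s => Num.min 1 ((hi - s) / (hi - lo)))).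
  exact: cvg_cst.
apply: (@continuous_min R R (fun=> 1) (fun s => (hi - s) / (hi - lo))).
  exact: cvg_cst.
apply: cvgM; last exact: cvg_cst.
by apply: cvgB; [exact: cvg_cst | exact: cvg_id].
Qed.

(** With the record N and r = (d + d')/2 < d', the arcs [0, r] and [-r, 0] have
    pairwise disjoint translates by h a, h < N, even after a slight widening
    to length d', while the arcs [h a - r, h a + r] cover the circle. *)
Lemma circle_towers (a : R) (M : nat) : irrational a ->
  exists (N : nat) (phi : bool -> R -> R), [/\ (M < N)%N,
    (forall b, continuous (phi b)),
    (forall b t (n : int), phi b (t + n%:~R) = phi b t),
    (forall b t, 0 <= phi b t <= 1) &
    (forall b t h h', (h < N)%N -> (h' < N)%N -> h != h' ->
       phi b (t - h%:R * a) * phi b (t - h'%:R * a) = 0) /\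
    (forall t, exists b, exists2 h, (h < N)%N & phi b (t - h%:R * a) = 1)].
Proof.
move=> ira; have [N [j [MN jN jmin dd']]] := record_returns M ira.
have cov := record_cover jN jmin dd'.
set d := int_dist (N%:R * a) in dd' cov.
set d' := int_dist (j%:R * a) in dd' cov jmin.
case/andP: dd' => d0 dd'; pose r := (d + d') / 2.
have rd' : r < d' by rewrite /r; lra.
have r0 : 0 < r by rewrite /r; lra.
have lh : r / 2 < d' / 2 by lra.
(* The arcs are centred at r/2 and -r/2 and have half-width r/2, so phi b is 1
   on the arc and vanishes from distance d'/2 to its centre. *)
pose c (b : bool) := if b then r / 2 else - (r / 2).
exists N, (fun b t => ramp (r / 2) (d' / 2) (int_dist (t - c b))); split => //.
- move=> b t.
  apply: (@continuous_comp _ _ _ (fun t => int_dist (t - c b))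
    (ramp (r / 2) (d' / 2))); last exact: ramp_continuous.
  apply: (@continuous_comp _ _ _ (fun t => t - c b) int_dist).
    by apply: cvgB; [exact: cvg_id|exact: cvg_cst].
  exact: int_dist_continuous.
- by move=> b t n; rewrite addrAC int_distDz.
- by move=> b t; exact: ramp_itv.
split.
  move=> b t h h' hN h'N hh'; apply/eqP; rewrite mulf_eq0.
  apply: contraT; rewrite negb_or => /andP[/(ramp_neq0 lh) A /(ramp_neq0 lh) B].
  exfalso; move: hh' A B; wlog lth : h h' hN h'N / (h < h')%N.
    move=> W; case: (ltngtP h h') => // lth _ A B.
      by apply: (W h h') => //; rewrite neq_ltn lth.
    by apply: (W h' h) => //; rewrite neq_ltn lth ?orbT.
  move=> _ A B; have := jmin (h' - h)%N; rewrite subn_gt0 lth /=.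
  have -> : (h' - h < N)%N by lia.
  move=> /(_ isT); rewrite leNgt => /negP; apply.
  rewrite natrB ?(ltnW lth) //.
  have := int_distB (t - h%:R * a - c b) (t - h'%:R * a - c b).
  rewrite [X in int_dist X](_ : _ = (h'%:R - h%:R) * a); last by ring.
  move=> le; apply: le_lt_trans le _; lra.
move=> t; have [h hN ht] := cov t.
have [n nE] := int_dist_ex (t - h%:R * a); rewrite -/d -/d' -/r nE in ht.
have [pos|neg] := lerP 0 (t - h%:R * a - n%:~R).
  exists true, h => //; apply: ramp1 => //; rewrite /c.
  apply: le_trans (int_dist_le _ n) _; rewrite ger0_norm // in ht.
  by rewrite ler_norml; apply/andP; split; lra.
exists false, h => //; apply: ramp1 => //; rewrite /c.
apply: le_trans (int_dist_le _ n) _; rewrite ltr0_norm // in ht.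
by rewrite ler_norml; apply/andP; split; lra.
Qed.

End distance_to_integers.

(** * Continuity, compactness and bump functions *)

Section topology_tools.
Variable R : realType.

Lemma lipschitz_continuous (X : metricType R) (f : X -> R) :
  (forall x y, f x <= f y + mdist x y) -> continuous f.
Proof.
move=> lip x; apply/cvgrPdist_lt => e e0; near=> y.
have xy : mdist x y < e.
  by near: y; apply: (metricType_numDomainType.cvgr_dist_lt cvg_id).
have h1 := lip x y; have := lip y x; rewrite metric_sym => h2.
by rewrite ltr_norml; apply/andP; split; lra.
Unshelve. all: by end_near. Qed.

Lemma continuous_mdist (X : metricType R) (Z : topologicalType)
    (f g : Z -> X) : continuous f -> continuous g ->
  continuous (fun z => mdist (f z) (g z)).
Proof.
move=> cf cg z; apply/cvgrPdist_lt => e e0.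
have e2 : 0 < e / 2 by rewrite divr_gt0.
near=> w.
have h1 : mdist (f z) (f w) < e / 2.
  near: w; exact: (metricType_numDomainType.cvgr_dist_lt (cf z)).
have h2 : mdist (g z) (g w) < e / 2.
  near: w; exact: (metricType_numDomainType.cvgr_dist_lt (cg z)).
have t1 := metric_triangle (f z) (f w) (g z).
have t2 := metric_triangle (f w) (g w) (g z).
have t3 := metric_triangle (f w) (f z) (g w).
have t4 := metric_triangle (f z) (g z) (g w).
move: t2 t3; rewrite (metric_sym (g w)) (metric_sym (f w) (f z)) => t2 t3.
by rewrite ltr_norml; apply/andP; split; lra.
Unshelve. all: by end_near. Qed.

Lemma continuous_sum (Z : topologicalType) (I : finType) (f : I -> Z -> R) :
  (forall i, continuous (f i)) -> continuous (fun z => \sum_i f i z).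
Proof.
move=> cf; apply: continuous_big => //; exact: add_continuous.
Qed.

Lemma continuous_prod (Z : topologicalType) (I : finType) (f : I -> Z -> R) :
  (forall i, continuous (f i)) -> continuous (fun z => \prod_i f i z).
Proof.
move=> cf; apply: continuous_big => //; exact: mul_continuous.
Qed.

Lemma continuous_bigmax (Z : topologicalType) (I : finType) (f : I -> Z -> R) :
  (forall i, continuous (f i)) ->
  continuous (fun z => \big[Num.max/0]_i f i z).
Proof.
move=> cf; apply: continuous_big => // -[x y].
apply: (@continuous_max R _ fst snd); [exact: cvg_fst|exact: cvg_snd].
Qed.

(** The quantitative form of an implication between closed and open conditions
    on a compact space; it yields both uniform continuity and the stability of
    an eps-embedding under small perturbations. *)
Lemma compact_imply (Z : topologicalType) (h D : Z -> R) (e : R) :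
    compact [set: Z] -> continuous h -> continuous D ->
    (forall z, h z <= 0 -> D z < e) ->
  exists2 eta, 0 < eta & forall z, h z <= eta -> D z < e.
Proof.
move=> /compact_near_coveringP cZ ch cD hD.
have := cZ R 0^'+ (fun eta z => h z <= eta -> D z < e) _.
case=> [z _|eta /= eta0 etaP].
  have [h0|h0] := lerP (h z) 0.
    exists ([set z' | D z' < e], setT) => /=; last by case=> z' eta [/= A _] _.
    split; last exact: filterT.
    exact: (cvgr_lt _ (cD z) _ (hD z h0)).
  exists ([set z' | h z / 2 < h z'], [set eta | eta < h z / 2]) => /=.
    split; first by apply: (cvgr_gt _ (ch z)); rewrite ltr_pdivrMr// ltr_pMr// ltr1n.
    by apply: nbhs_right_lt; rewrite divr_gt0.
  case=> z' eta [/= A B] zeta.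
  by have := lt_trans A (le_lt_trans zeta B); rewrite ltxx.
exists (eta / 2); first by rewrite divr_gt0.
move=> z; apply: etaP => //=; last by rewrite divr_gt0.
by rewrite sub0r normrN gtr0_norm ?divr_gt0 //; lra.
Qed.

Lemma compact_finite_weights (X : topologicalType) (f : X -> X -> R) :
    compact [set: X] -> (forall x, continuous (f x)) -> (forall x, 0 < f x x) ->
  exists s : seq X, forall y, exists2 i : 'I_(size s), True & 0 < f (tnth (in_tuple s) i) y.
Proof.
move=> cX cf f0.
have [[x0 _]|X0] := pselect (exists x : X, True); last first.
  by exists [::] => y; exfalso; apply: X0; exists y.
(* A base point makes X a pointed space, as compact_cover asks. *)
pose Y : ptopologicalType := HB.pack X (isPointed.Build X x0).
have : compact [set: Y] by [].
rewrite compact_cover => /(_ X setT (fun x => [set y | 0 < f x y])).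
case=> [x _||D _ DP].
- have /continuousP/(_ [set r | 0 < r]) := cf x; apply; exact: open_gt.
- move=> y _; exists y => //=; exact: f0.
exists (enum_fset D) => y; have [x xD /= fx] := DP y I.
have xs : (index x (enum_fset D) < size (enum_fset D))%N by rewrite index_mem.
by exists (Ordinal xs) => //; rewrite (tnth_nth x0) /= nth_index.
Qed.

(** The distance to the complement of A, truncated at 1 so that it is also
    defined when A is the whole space. *)
Definition room (X : metricType R) (A : set X) (x : X) : R :=
  sup [set r | 0 <= r <= 1 /\ forall y, mdist x y < r -> A y].

Section room.
Variables (X : metricType R) (A : set X).

Let has_sup_room x :
  has_sup [set r : R | 0 <= r <= 1 /\ forall y, mdist x y < r -> A y].
Proof.
split; first exists 0.
  by split; rewrite ?lexx ?ler01 // => y; rewrite ltNge mdist_ge0.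
by exists 1 => r [/andP[]].
Qed.

Lemma room_ge0 x : 0 <= room A x.
Proof.
apply: ub_le_sup; first by case: (has_sup_room x).
by split; rewrite ?lexx ?ler01 // => y; rewrite ltNge mdist_ge0.
Qed.

Lemma room_gt0 x : open A -> 0 < room A x <-> A x.
Proof.
move=> oA; split => [/(sup_gt _)|Ax].
  case=> [|r [_ rA] r0]; first by case: (has_sup_room x).
  by apply: rA; rewrite mdistxx.
have : nbhs x A by exact: open_nbhs_nbhs.
move=> /metricType_numDomainType.nbhs_mdistP[e /= e0 eA].
apply: (@lt_le_trans _ _ (Num.min 1 e)); first by rewrite lt_min ltr01.
apply: ub_le_sup; first by case: (has_sup_room x).
split=> [|y]; first by rewrite le_min ler01 ltW //= ge_min lexx.
by rewrite lt_min => /andP[_ ?]; exact: eA.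
Qed.

Lemma room_continuous : continuous (room A).
Proof.
apply: lipschitz_continuous => x y.
apply: ge_sup; first by case: (has_sup_room x).
move=> r [/andP[r0 r1] rA]; rewrite -lerBlDr.
have [neg|pos] := ltP (r - mdist x y) 0.
  by apply: le_trans (ltW neg) (room_ge0 _).
apply: ub_le_sup; first by case: (has_sup_room y).
split=> [|z yz].
  by rewrite pos /=; have := mdist_ge0 x y; lra.
apply: rA; have := metric_triangle x y z; lra.
Qed.
End room.

End topology_tools.

(** * Covers as families of weights, and colours *)

Section weights.
Variables (R : realType) (k : nat) (X : metricType R) (T : Zk_action k X).
Hypothesis cX : compact [set: X].

(** An open cover of order at most m whose members have diameter at most eps
    after translation by every element of B.  Its members are given as the
    supports of continuous weights, since partitions of unity and thresholds
    are what the covers are used for. *)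
Definition weights (B : set 'rV[int]_k) (eps : R) (m : nat) : Prop :=
  exists (I : finType) (f : I -> X -> R),
    [/\ (forall i, continuous (f i)), (forall i x, 0 <= f i x),
      (forall x, exists i, 0 < f i x),
      (forall i x y, 0 < f i x -> 0 < f i y ->
         forall g, B g -> mdist (T g x) (T g y) <= eps)
    & forall x, (#|[pred i | (0 < f i x)%R]| <= m.+1)%N].

Definition pos_part (r : R) : R := Num.max 0 r.

Lemma pos_part_ge0 r : 0 <= pos_part r. Proof. by rewrite /pos_part le_max lexx. Qed.

Lemma pos_part_gt0 r : (0 < pos_part r) = (0 < r).
Proof. by rewrite /pos_part lt_max ltxx. Qed.

Lemma pos_part_continuous (Z : topologicalType) (f : Z -> R) :
  continuous f -> continuous (fun z => pos_part (f z)).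
Proof.
move=> cf z; apply: (@continuous_max R Z (fun=> 0) f); first exact: cvg_cst.
exact: cf.
Qed.

Lemma prod_gt0P (I : finType) (F : I -> R) : (forall i, 0 <= F i) ->
  0 < \prod_i F i <-> forall i, 0 < F i.
Proof.
move=> F0; split=> [P i|P]; last by apply: prodr_gt0 => i _.
rewrite lt_neqAle F0 andbT eq_sym; apply: contraTneq P => Fi0.
by rewrite (bigD1 i) //= Fi0 mul0r ltxx.
Qed.

Lemma weights_ex (H : finType) (be : H -> 'rV[int]_k) eps : 0 < eps ->
  exists m, weights (range be) eps m.
Proof.
move=> eps0.
pose f (x y : X) : R :=
  \prod_(h : H) pos_part (eps / 2 - mdist (T (be h) x) (T (be h) y)).
have cf x : continuous (f x).
  apply: continuous_prod => h; apply: pos_part_continuous => y.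
  apply: cvgB; first exact: cvg_cst.
  apply: (@continuous_mdist R X X (fun=> T (be h) x) (T (be h))).
    by move=> z; exact: cvg_cst.
  exact: act_continuous.
have f0 x y : 0 <= f x y by apply: prodr_ge0 => h _; exact: pos_part_ge0.
have fxx x : 0 < f x x.
  by apply/prod_gt0P => [h|h]; rewrite ?pos_part_ge0 // pos_part_gt0 mdistxx subr0 divr_gt0.
have [s sP] := compact_finite_weights cX cf fxx.
exists (size s), 'I_(size s), (fun i => f (tnth (in_tuple s) i)); split=> //.
- by move=> x; have [i _ ?] := sP x; exists i.
- move=> i x y /prod_gt0P fx /prod_gt0P fy _ [h _ <-].
  have := fx (fun=> pos_part_ge0 _) h; have := fy (fun=> pos_part_ge0 _) h.
  rewrite !pos_part_gt0; set z := tnth _ _ => A C.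
  have := metric_triangle (T (be h) x) (T (be h) z) (T (be h) y).
  rewrite (metric_sym (T (be h) x) (T (be h) z)); lra.
- by move=> x; apply: leq_trans (max_card _) _; rewrite card_ord.
Qed.

(** Subadditivity of the order, by Kolmogorov's colouring trick.  Normalise the
    weights to maximum 1 and choose a threshold t_j in (0, 1) for each colour
    j.  The sets where the weights above t_j are exactly those of a given
    set of indices are disjoint for a fixed j, and they miss only the points
    where some weight is equal to t_j.  At a point, at most m weights lie
    strictly between 0 and 1, so at most m colours miss it.  Doing this for
    all |A| translates at once, a point is missed by at most |A| m colours.
    With |A| m + 1 colours, everything is covered, and each colour covers a
    point at most once. *)
Lemma join_translates (A : finType) (s : A -> 'rV[int]_k)
    (B B' : set 'rV[int]_k) eps m :
    (forall g, B' g -> exists h a, B h /\ g = h + s a) ->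
  weights B eps m -> weights B' eps (#|A| * m).
Proof.
move=> BB' [I [f [cf f0 fex feps fm]]].
(* The weights are not normalised; their maximum mx multiplies the thresholds. *)
pose M := (#|A| * m).+1.
pose mx x := \big[Num.max/0]_i f i x.
have cmx : continuous mx by exact: continuous_bigmax.
have mx_ge i x : f i x <= mx x by apply: le_bigmax.
have mx_gt0 x : 0 < mx x by have [i fi] := fex x; exact: lt_le_trans fi (mx_ge i x).
have mx_ex x : exists i, f i x = mx x.
  have [i0 _] := fex x; rewrite /mx.
  have [i _ ->] := @eq_bigmax _ _ I 0 i0 predT (f^~ x) isT (fun i _ => f0 i x).
  by exists i.
pose t (j : 'I_M) : R := j.+1%:R / M.+1%:R.
have t0 j : 0 < t j by rewrite divr_gt0 // ltr0n.
have t1 j : t j < 1 by rewrite ltr_pdivrMr ?ltr0n // mul1r ltr_nat ltnS.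
have t_inj : injective t.
  move=> j j' /(mulIf _) E; apply/val_inj/succn_inj/eqP.
  by rewrite -(eqr_nat R) E // invr_eq0 pnatr_eq0.
pose sg (b : bool) : R := if b then 1 else -1.
pose term (j : 'I_M) (b : {ffun A * I -> bool}) (ai : A * I) (x : X) : R :=
  sg (b ai) * (f ai.2 (T (s ai.1) x) - t j * mx (T (s ai.1) x)).
have term_gt0 j b ai x : 0 < term j b ai x ->
    b ai = (t j * mx (T (s ai.1) x) < f ai.2 (T (s ai.1) x)).
  rewrite /term /sg; case: (b ai); first by rewrite mul1r subr_gt0.
  rewrite mulN1r oppr_gt0 subr_lt0 => lt; apply/esym/negbTE.
  by rewrite -leNgt ltW.
(* The weight of the cell of colour j in which the indices (a, i) above the
   threshold are those with b (a, i). *)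
pose w (jb : 'I_M * {ffun A * I -> bool}) (x : X) : R :=
  \prod_(ai : A * I) pos_part (term jb.1 jb.2 ai x).
have w_gt0 jb x : 0 < w jb x <-> forall ai, 0 < term jb.1 jb.2 ai x.
  rewrite /w; split => [/prod_gt0P P ai|P].
    by rewrite -pos_part_gt0; apply: P => i; exact: pos_part_ge0.
  by apply/prod_gt0P => ai; rewrite ?pos_part_ge0 // pos_part_gt0.
exists ('I_M * {ffun A * I -> bool})%type, w; split.
- move=> jb; apply: continuous_prod => ai; apply: pos_part_continuous => x.
  apply: cvgM; first exact: cvg_cst.
  have cT := @act_continuous _ _ T (s ai.1).
  apply: cvgB; last apply: cvgM; first 2 last.
  + apply: (@continuous_comp _ _ _ (T (s ai.1)) mx); [exact: cT|exact: cmx].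
  + apply: (@continuous_comp _ _ _ (T (s ai.1)) (f ai.2)); [exact: cT|exact: cf].
  + exact: cvg_cst.
- by move=> jb x; apply: prodr_ge0 => ai _; exact: pos_part_ge0.
- move=> x.
  pose bad (a : A) : {set 'I_M} :=
    [set j | [exists i, f i (T (s a) x) == t j * mx (T (s a) x)]]%SET.
  have bad_card a : (#|bad a| <= m)%N.
    (* Sending a bad colour j to the index of a weight equal to t_j is injective
       and misses i1, whose weight is maximal. *)
    set y := T (s a) x; have [i1 i1E] := mx_ex y.
    pose pk (j : 'I_M) : I := odflt i1 [pick i | f i y == t j * mx y].
    have pkP j : j \in bad a -> f (pk j) y = t j * mx y.
      rewrite inE /pk => /existsP[i ij]; case: pickP => [? /eqP //|/(_ i)].
      by rewrite ij.
    have pk_inj : {in bad a &, injective pk}.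
      move=> j j' jb j'b E; apply: t_inj; apply: (mulIf (lt0r_neq0 (mx_gt0 y))).
      by rewrite -!pkP // E.
    rewrite -(card_in_imset pk_inj).
    have := fm y; rewrite (cardD1 i1 [pred i | (0 < f i y)%R]) inE i1E mx_gt0 add1n ltnS; apply: leq_trans.
    apply/subset_leq_card/fintype.subsetP => i /imsetP[j jb ->].
    rewrite !inE pkP // mulr_gt0 // andbT; apply/eqP => pi1.
    have := pkP _ jb; rewrite pi1 i1E => /eqP; rewrite -{1}[mx y]mul1r.
    rewrite -subr_eq0 -mulrBl mulf_eq0 subr_eq0 => /orP[|]/eqP E.
      by have := t1 j; rewrite -E ltxx.
    by have := mx_gt0 y; rewrite E ltxx.
  have [j jgood] : exists j : 'I_M, forall a, j \notin bad a.
    apply: contrapT => nex.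
    have : (#|(\bigcup_a bad a)%SET| <= \sum_(a : A) #|bad a|)%N.
      elim/big_rec2: _ => [|a S D _ IH]; first by rewrite cards0.
      by apply: leq_trans (leq_card_setU _ _) _; rewrite leq_add2l.
    rewrite (_ : (\bigcup_a bad a)%SET = [set: 'I_M]%SET); last first.
      apply/setP => j; rewrite finset.in_setT; apply/finset.bigcupP.
      apply: contrapT => nja; apply: nex; exists j => a; apply/negP => ja.
      by apply: nja; exists a.
    rewrite cardsT card_ord leqNgt ltnS => /negP; apply.
    by rewrite -sum_nat_const; apply: leq_sum => a _; exact: bad_card.
  exists (j, [ffun ai => t j * mx (T (s ai.1) x) < f ai.2 (T (s ai.1) x)]).
  apply/w_gt0 => -[a i]; rewrite /term /= ffunE /= /sg.
  case: (ltrP (t j * mx (T (s a) x))) => [lt|] /=; first by rewrite mul1r subr_gt0.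
  rewrite le_eqVlt mulN1r oppr_gt0 subr_lt0 => /orP[/eqP E|//].
  have := jgood a; rewrite inE => /existsPn/(_ i); rewrite E eqxx.
  by [].
- move=> [j b] x y /w_gt0 wx /w_gt0 wy _ /BB'[h [a [Bh ->]]].
  rewrite !actD; have [i iE] := mx_ex (T (s a) x).
  have := term_gt0 _ _ _ _ (wx (a, i)); rewrite /= iE.
  rewrite gtr_pMl ?t1 // => bT.
  have := term_gt0 _ _ _ _ (wy (a, i)); rewrite /= bT => /esym ylt.
  apply: (feps i) => //; first by rewrite iE.
  by apply: le_lt_trans ylt; rewrite mulr_ge0 ?ltW // mx_gt0.
- move=> x; rewrite -[X in (_ <= X)%N](card_ord M).
  have inj : {in [pred jb | 0 < w jb x] &, injective (fst : 'I_M * {ffun A * I -> bool} -> _)}.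
    move=> [j b] [j' b']; rewrite !inE => /w_gt0 wx /w_gt0 wy /= E.
    rewrite -E in wy *; congr pair; apply/ffunP => ai.
    by rewrite (term_gt0 _ _ _ _ (wx ai)) (term_gt0 _ _ _ _ (wy ai)).
  rewrite -(card_in_image inj); exact: max_card.
Qed.
End weights.

(** * Width dimension of boxes *)

Section mean_dimension_bounds.
Variables (R : realType) (k : nat) (X : metricType R) (T : Zk_action k X).
Hypothesis cX : compact [set: X].

Definition box (N : 'I_k -> nat) : set 'rV[int]_k :=
  [set v | forall i, (0 <= v ord0 i)%R && (v ord0 i < (N i)%:Z)%R].

Lemma box_ffun (N : 'I_k -> nat) :
  box N = range (fun g : {dffun forall i, 'I_(N i)} => \row_i (g i)%:Z).
Proof.
apply/seteqP; split=> [v vN|_ [g _ <-] i]; last first.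
  by rewrite mxE ltz_nat ltn_ord.
have b i : (`|v ord0 i| < N i)%N.
  by have /andP[v0 vi] := vN i; rewrite -ltz_nat gez0_abs.
exists [ffun i => Ordinal (b i)] => //; apply/rowP => i.
by rewrite mxE ffunE /= gez0_abs //; have /andP[] := vN i.
Qed.

Lemma dyn_dist_le n x y (eps : R) : 0 <= eps ->
  dyn_dist T n x y <= eps <->
  forall g, box (fun=> n) g -> mdist (T g x) (T g y) <= eps.
Proof.
move=> eps0; split=> [le g|le].
  rewrite box_ffun => -[h _ <-]; apply: le_trans le.
  rewrite /dyn_dist.
  pose F (g : {ffun 'I_k -> 'I_n}) :=
    mdist (T (\row_i (g i)%:Z) x) (T (\row_i (g i)%:Z) y).
  exact: (@le_bigmax _ _ _ 0 F h).
by apply: bigmax_le => // h _; apply: le; rewrite box_ffun; exists h.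
Qed.

Lemma multiplicity_le (U : set (set X)) (x : X) (m : nat) :
  finite_set U ->
  (forall s : seq (set X), uniq s -> (forall A, A \in s -> U A /\ A x) ->
     (size s <= m)%N) -> (multiplicity U x <= m)%N.
Proof.
move=> finU H; apply: H; first exact: fset_uniq.
move=> A; rewrite -[A \in _]/(A \in fset_set _) in_fset_set.
  by rewrite inE.
by apply: sub_finite_set finU => B [].
Qed.

Lemma weights_cover (x0 : X) n eps m : 0 <= eps ->
    weights T (box (fun=> n)) eps m ->
  exists2 m', (m' <= m)%N & has_eps_cover_of_order (dyn_dist T n) eps m'.
Proof.
move=> eps0 [I [f [cf f0 fex feps fm]]].
pose V i : set X := [set x | 0 < f i x].
pose U : set (set X) := range V.
have finU : finite_set U by exact: finite_image.
have multU x : (multiplicity U x <= m.+1)%N.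
  apply: multiplicity_le => // s us sP; apply: leq_trans (fm x).
  have ex A : exists i, A \in s -> A = V i /\ 0 < f i x.
    have [As|nAs] := boolP (A \in s); last first.
      by have [i _] := fex x; exists i.
    have [[i _ iA] Ax] := sP A As; exists i => _; split => //.
    by move: Ax; rewrite -iA.
  have /choice[c cP] := ex.
  rewrite cardE -(size_map c); apply: uniq_leq_size.
    rewrite map_inj_in_uniq // => A B As Bs cAB.
    by rewrite (cP A As).1 (cP B Bs).1 cAB.
  by move=> _ /mapP[A As ->]; rewrite mem_enum inE; case: (cP A As).
have ex : exists j, `[< exists x, multiplicity U x = j >].
  by exists (multiplicity U x0); apply/asboolP; exists x0.
have bd j : `[< exists x, multiplicity U x = j >] -> (j <= m.+1)%N.
  by move=> /asboolP[x <-].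
case: (ex_maxnP ex bd) => j /asboolP[x1 x1j] jmax.
have j0 : (0 < j)%N.
  rewrite -x1j /multiplicity cardfs_gt0; have [i fi] := fex x1.
  apply/fset0Pn; exists (V i); rewrite in_fset_set.
    by rewrite inE; split => //; exists i.
  by apply: sub_finite_set finU => B [].
exists j.-1; first by rewrite -ltnS prednK // -x1j.
exists U; split=> //.
- by move=> _ [i _ <-]; have /continuousP/(_ [set r | 0 < r]) := cf i; apply; exact: open_gt.
- by apply/seteqP; split=> // x _; have [i fi] := fex x; exists (V i) => //; exists i.
- move=> _ [i _ <-] x y Vx Vy; apply/dyn_dist_le => // g Bg.
  exact: (feps i).
- split; last by exists x1; rewrite prednK.
  move=> x; rewrite prednK //; apply: jmax; apply/asboolP; by exists x.
Qed.

Lemma cover_weights n eps m : 0 <= eps ->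
  has_eps_cover_of_order (dyn_dist T n) eps m ->
  weights T (box (fun=> n)) eps m.
Proof.
move=> eps0 [U [finU oU covU epsU [mU _]]].
exists (fset_set U), (fun A => room (fsval A)).
have UA (A : fset_set U) : U (fsval A).
  by have := fsvalP A; rewrite in_fset_set // inE.
split.
- by move=> A; exact: room_continuous.
- by move=> A x; exact: room_ge0.
- move=> x; have : (\bigcup_(A in U) A) x by rewrite covU.
  case=> A UAA Ax; have Af : A \in fset_set U by rewrite in_fset_set // inE.
  by exists [` Af]%fset => /=; apply/room_gt0 => //; exact: oU.
- move=> A x y /room_gt0 Ax /room_gt0 Ay; apply/dyn_dist_le => //.
  by apply: (epsU _ (UA A)); [apply: Ax|apply: Ay]; exact: oU.
- move=> x; apply: leq_trans (mU x).
  rewrite /multiplicity cardE -(size_map (val : fset_set U -> set X)).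
  apply: uniq_leq_size; first by rewrite map_inj_uniq ?enum_uniq //; exact: val_inj.
  move=> A /mapP[B]; rewrite mem_enum inE => /room_gt0 BB ->.
  rewrite -[_ \in _]/(_ \in fset_set _) in_fset_set.
    by rewrite inE; split; [exact: UA | apply: BB; exact: oU (UA B)].
  by apply: sub_finite_set finU => C [].
Qed.

Lemma widim_weights (x0 : X) n eps : 0 < eps ->
  weights T (box (fun=> n)) eps (widim (dyn_dist T n) eps) /\
  forall m, weights T (box (fun=> n)) eps m ->
    (widim (dyn_dist T n) eps <= m)%N.
Proof.
move=> eps0.
have [m0 wm0] := weights_ex T cX (fun g : {dffun forall i : 'I_k, 'I_n} => \row_i (g i)%:Z) eps0.
rewrite -box_ffun in wm0.
have [m1 _ cm1] := weights_cover x0 (ltW eps0) wm0.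
have ex : exists m, `[< has_eps_cover_of_order (dyn_dist T n) eps m >].
  by exists m1; apply/asboolP.
have [j /asboolP jc jmin] := ex_minnP ex.
have jE : widim (dyn_dist T n) eps = j.
  rewrite /widim; case: xgetP => [w -> [wc wmin]|].
    apply/eqP; rewrite eqn_leq wmin //= jmin //; exact/asboolP.
  move=> /(_ j) /= []; split=> // m mc; apply: jmin; exact/asboolP.
rewrite jE; split; first by apply: cover_weights => //; exact: ltW.
move=> m wm; have [m' m'm c'] := weights_cover x0 (ltW eps0) wm.
by apply: leq_trans m'm; apply: jmin; exact/asboolP.
Qed.

(** Division with remainder in each coordinate covers the box of sides N by
    translates of the box of sides M. *)
Lemma box_join (N M : 'I_k -> nat) eps w :
    (forall i, 0 < M i)%N -> weights T (box M) eps w ->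
  weights T (box N) eps (\prod_i (N i %/ M i).+1 * w).
Proof.
move=> M0 wM.
pose A := {dffun forall i : 'I_k, 'I_(N i %/ M i).+1}.
have <- : #|{: A}| = \prod_i (N i %/ M i).+1.
  by rewrite card_dep_ffun foldrE big_map big_enum; apply: eq_bigr => i _; rewrite card_ord.
apply: (join_translates (s := fun a : A => \row_i (a i * M i)%:Z)) wM.
move=> g gN; pose n i := `|g ord0 i|%N.
have gn i : g ord0 i = (n i)%:Z by rewrite /n gez0_abs //; have /andP[] := gN i.
have nN i : (n i < N i)%N by have /andP[_] := gN i; rewrite gn ltz_nat.
have b i : (n i %/ M i < (N i %/ M i).+1)%N.
  by rewrite ltnS leq_div2r // ltnW.
exists (\row_i (n i %% M i)%:Z), [ffun i => Ordinal (b i)]; split.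
  by move=> i; rewrite mxE ltz_nat ltn_mod M0.
by apply/rowP => i; rewrite !mxE ffunE /= gn -PoszD addnC -divn_eq.
Qed.

End mean_dimension_bounds.

(** * The limit that defines mean dimension *)

Section mean_dimension_limit.
Variable R : realType.

(** The crude factor 3 ^ k makes the induction immediate; only the linear order
    in x matters, to compare the volumes of slightly enlarged boxes. *)
Lemma bernoulli_upper (x : R) (k : nat) : 0 <= x <= 1 ->
  (1 + x) ^+ k <= 1 + (3 ^ k)%:R * x.
Proof.
move=> /andP[x0 x1]; elim: k => [|k IH]; first by rewrite expr0 mul1r lerDl.
have p0 : 1 <= (3 ^ k)%:R :> R by rewrite ler1n expn_gt0.
rewrite exprSr expnS natrM; apply: le_trans (ler_wpM2r _ IH) _; first by lra.
set c := (3 ^ k)%:R in p0 *; rewrite -subr_ge0.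
rewrite (_ : _ - _ = x * (c * (1 - x) + (c - 1))); last by ring.
by rewrite mulr_ge0 // addr_ge0 ?mulr_ge0 ?subr_ge0 //; lra.
Qed.

(** Fekete's lemma for cubes: covering the cube of side N by (N/n + 1)^k cubes
    of side n gives u N <= u n (1 + n/N)^k, so the limit is the infimum. *)
Lemma box_subadditive_cvg (W : nat -> nat) (k : nat) :
    (0 < k)%N ->
    (forall n N, (0 < n)%N -> (W N <= (N %/ n).+1 ^ k * W n)%N) ->
  let u n : R := (W n)%:R / (n ^ k)%:R in
  u @ \oo --> inf [set u n | n in [set n | 0 < n]%N].
Proof.
move=> k0 sub u; set S := (X in inf X).
have u0 n : 0 <= u n by rewrite divr_ge0.
have hS : has_inf S.
  split; first by exists (u 1%N); exists 1%N.
  by exists 0 => _ [n _ <-].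
apply/cvgrPdist_le => e e0.
have e2 : 0 < e / 2 by rewrite divr_gt0.
have [_ [n /= n0 <-] un] := inf_adherent e2 hS.
set l := inf S in un *.
have lS m : (0 < m)%N -> l <= u m.
  by move=> m0; apply: ge_inf; [case: hS | exists m].
pose c : R := u n * ((3 ^ k)%:R * n%:R).
have c0 : 0 <= c by rewrite mulr_ge0.
near=> N.
have N0 : (0 < N)%N by near: N; exact: nbhs_infty_gt.
have nN : (n <= N)%N by near: N; exact: nbhs_infty_ge.
have cN : c / (e / 2) <= N%:R by near: N; exact: nbhs_infty_ger.
have NR : 0 < N%:R :> R by rewrite ltr0n.
have nR : 0 < n%:R :> R by rewrite ltr0n.
have le1 : u N <= u n * (1 + n%:R / N%:R) ^+ k.
  rewrite /u ler_pdivrMr ?ltr0n ?expn_gt0 ?N0 //.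
  rewrite [leRHS](_ : _ = (W n)%:R * (N%:R / n%:R + 1) ^+ k); last first.
    rewrite !natrX -exprVn -!mulrA -!exprMn; congr (_ * _ ^+ k).
    by field; rewrite !gt_eqF.
  apply: le_trans (_ : ((N %/ n).+1 ^ k * W n)%:R <= _); first by rewrite ler_nat sub.
  rewrite natrM natrX mulrC ler_wpM2l // lerXn2r ?nnegrE // ?addr_ge0 // ?divr_ge0 //.
  rewrite -natr1 lerD2r ler_pdivlMr // -natrM ler_nat; exact: leq_divM.
have le2 : u N <= u n + c / N%:R.
  apply: le_trans le1 _.
  have /(bernoulli_upper k) B : 0 <= (n%:R / N%:R : R) <= 1.
    by rewrite divr_ge0 //= ler_pdivrMr // mul1r ler_nat.
  apply: le_trans (ler_wpM2l (u0 n) B) _.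
  by rewrite /c mulrDr mulr1 !mulrA.
have le3 : c / N%:R <= e / 2.
  by rewrite ler_pdivrMr // mulrC -ler_pdivrMr.
have := lS N N0 => le4.
by rewrite ler_norml; apply/andP; split; lra.
Unshelve. all: by end_near. Qed.

Variables (k : nat) (X : metricType R) (T : Zk_action k X).
Hypothesis cX : compact [set: X].
Variable x0 : X.
Hypothesis k0 : (0 < k)%N.

(** Because the limit is an infimum, the bound on mdim is witnessed by one
    cube for each eps. *)
Lemma mdim_lt_weights (L : nat) (eps : R) : 0 < eps ->
    (mdim T < (L%:R / 2)%:E)%E ->
  exists2 n, (0 < n)%N & exists2 w, (2 * w < L * n ^ k)%N &
    weights T (box (fun=> n)) eps w.
Proof.
move=> eps0 md.
pose W n := widim (dyn_dist T n) eps.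
have sub n N : (0 < n)%N -> (W N <= (N %/ n).+1 ^ k * W n)%N.
  move=> n0; apply: (widim_weights T cX x0 N eps0).2.
  have := box_join (fun=> N) (fun=> n0) (widim_weights T cX x0 n eps0).1.
  by rewrite prod_nat_const card_ord.
pose u n : R := (W n)%:R / (n ^ k)%:R.
have cu := box_subadditive_cvg k0 sub.
have : limn u < L%:R / 2.
  rewrite -lte_fin; apply: le_lt_trans md; apply: ereal_sup_ubound.
  by exists eps.
rewrite (cvg_lim _ cu) // => /inf_lt[].
  by exists (u 1%N), 1%N.
move=> _ [n /= n0 <-] un; exists n => //; exists (W n).
  rewrite -(ltr_nat R) !natrM; move: un.
  by rewrite ltr_pdivrMr ?ltr0n ?expn_gt0 ?n0 // mulrAC ltr_pdivlMr // mulrC.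
exact: (widim_weights T cX x0 n eps0).1.
Qed.

(** The strict inequality 2 w < L n^k at one cube leaves a relative margin of
    at least 1 / (L n^k), which absorbs both the overlap of the cubes of side
    n at the faces of a large box and the additional 1. *)
Lemma mdim_lt_box (L : nat) (eps : R) : (0 < L)%N -> 0 < eps ->
    (mdim T < (L%:R / 2)%:E)%E ->
  exists M, forall N : 'I_k -> nat, (forall i, M <= N i)%N ->
    exists2 m, (2 * m + 1 <= L * \prod_i N i)%N & weights T (box N) eps m.
Proof.
move=> L0 eps0 md; have [n n0 [w wn wT]] := mdim_lt_weights eps0 md.
(* This M makes the overlap L 3^k n/M equal to half of 1/n^k, see LM; the other
   half, multiplied by P >= M >= 2 n^k, pays for the 1. *)
pose M := (2 * L * 3 ^ k * n ^ k * n)%N.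
exists M => N MN; exists (\prod_i (N i %/ n).+1 * w)%N; last first.
  exact: (box_join N (fun=> n0) wT).
have n_k : (0 < n ^ k)%N by rewrite expn_gt0 n0.
have M0 : (0 < M)%N by rewrite /M !muln_gt0 L0 expn_gt0 n_k n0.
set P := (\prod_i N i)%N.
set Q := (\prod_i (N i %/ n).+1)%N.
have i0 : 'I_k := Ordinal k0.
have Nge1 i : (0 < N i)%N by apply: leq_trans M0 (MN i).
have PM : (M <= P)%N.
  rewrite /P (bigD1 i0) //= -[M]muln1; apply: leq_mul; first exact: MN.
  by rewrite prodn_cond_gt0 // => i _; exact: Nge1.
have QP : (Q * n ^ k * M ^ k <= P * (M + n) ^ k)%N.
  rewrite -[k in (n ^ k)%N]card_ord -[k in (M ^ k)%N]card_ord.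
  rewrite -[k in ((M + n) ^ k)%N]card_ord -!prod_nat_const -!big_split /=.
  apply: leq_prod => i _.
  have le1 : ((N i %/ n).+1 * n <= N i + n)%N by rewrite mulSn addnC leq_add2r leq_divM.
  apply: leq_trans (leq_mul le1 (leqnn M)) _.
  by rewrite mulnDl mulnDr leq_add2l mulnC leq_mul2r MN orbT.
have nM : (n <= M)%N by rewrite /M leq_pmull // !muln_gt0 L0 expn_gt0 n_k.
have QPR : Q%:R * (n ^ k)%:R <= P%:R * (1 + (3 ^ k)%:R * (n%:R / M%:R)) :> R.
  have MR : 0 < M%:R :> R by rewrite ltr0n.
  have /(bernoulli_upper k) B : 0 <= (n%:R / M%:R : R) <= 1.
    by rewrite divr_ge0 //= ler_pdivrMr // mul1r ler_nat.
  apply: le_trans (ler_wpM2l (ler0n _ P) B).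
  have MkR : 0 < M%:R ^+ k :> R by rewrite exprn_gt0.
  rewrite -(ler_pM2r MkR) -mulrA -exprMn mulrDl mul1r divfK ?gt_eqF //.
  by rewrite -natrD -!natrX -!natrM ler_nat.
have nkR : 1 <= (n ^ k)%:R :> R by rewrite ler1n.
have LM : L%:R * (3 ^ k)%:R * (n%:R / M%:R) = (2 * (n ^ k)%:R)^-1 :> R.
  rewrite /M !natrM; field.
  by rewrite !pnatr_eq0 -!lt0n n_k n0 L0 expn_gt0.
have PMR : 2 * (n ^ k)%:R <= P%:R :> R.
  rewrite -natrM ler_nat; apply: leq_trans PM.
  rewrite (_ : M = (2 * n ^ k) * (L * 3 ^ k * n))%N; last by rewrite /M; ring.
  by rewrite leq_pmulr // !muln_gt0 L0 n0 expn_gt0.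
have wR : 2 * w%:R + 1 <= L%:R * (n ^ k)%:R :> R by rewrite -natrM natr1 -natrM ler_nat.
suff : 2 * (Q%:R * w%:R) + 1 <= L%:R * P%:R :> R.
  by rewrite -!natrM natr1 ler_nat addn1.
set q := Q%:R in QPR *; set p := P%:R in QPR PMR *; set v := (n ^ k)%:R in nkR LM PMR wR QPR.
set t := (3 ^ k)%:R * (n%:R / M%:R) in QPR *.
have Lt : L%:R * t = (2 * v)^-1 :> R by rewrite -LM /t mulrA.
have v0 : 0 < v by lra.
have t0 : 0 <= t by rewrite mulr_ge0 // divr_ge0.
have p0 : 0 <= p by exact: ler0n.
rewrite -(ler_pM2r v0).
have e1 : q * v * (2 * w%:R) <= p * (1 + t) * (L%:R * v - 1).
  by apply: ler_pM => //; rewrite ?mulr_ge0 //; lra.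
have e2 : p * (1 + t) * (L%:R * v - 1) = p * L%:R * v + p * (L%:R * t) * v - p * (1 + t).
  by ring.
have e3 : (L%:R * t) * v = 1 / 2 by rewrite Lt; field; rewrite gt_eqF.
have e4 : p * (L%:R * t) * v = p / 2 by rewrite -mulrA e3; field.
have e5 : 0 <= p * t by rewrite mulr_ge0.
rewrite e2 e4 mulrDr mulr1 in e1.
rewrite mulrDl mul1r.
rewrite (_ : 2 * (q * w%:R) * v = q * v * (2 * w%:R)); last by ring.
rewrite (_ : L%:R * p * v = p * L%:R * v); last by ring.
lra.
Qed.

End mean_dimension_limit.

(** * General position and maps through the nerve *)

Section general_position.
Variable R : realType.

Lemma poly_nonroot (q : {poly R}) (d : R) : q != 0 -> 0 < d ->
  exists2 s, 0 < s <= d & q.[s] != 0.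
Proof.
move=> q0 d0; pose s (i : nat) : R := d / i.+1%:R.
have s_inj : injective s.
  move=> i j /(mulfI (lt0r_neq0 d0)) /invr_inj /eqP.
  by rewrite eqr_nat eqSS => /eqP.
apply: contrapT => nex; have := max_poly_roots q0 (rs := map s (iota 0 (size q))).
rewrite (map_inj_uniq s_inj) iota_uniq size_map size_iota ltnn.
suff ->  : all (root q) (map s (iota 0 (size q))) by move=> /(_ isT isT).
apply/allP => _ /mapP[i _ ->]; apply: contrapT => nr; apply: nex; exists (s i); last exact/negP.
by rewrite divr_gt0 //= ler_pdivrMr ?ltr0n // ler_peMr ?(ltW d0) // ler1n.
Qed.

Lemma enum_superset (J : finType) (S : {set J}) (n : nat) :
    (#|S| <= n)%N -> (n <= #|J|)%N ->
  exists2 sg : {ffun 'I_n -> J}, injective sg & forall j, j \in S -> exists b, j = sg b.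
Proof.
move=> Sn nJ; pose s := enum S ++ enum (~: S)%SET.
have us : uniq s.
  rewrite cat_uniq !enum_uniq andbT /=; apply/hasPn => j.
  by rewrite /= !mem_enum inE.
have ss : size s = #|J| by rewrite size_cat -!cardE cardsC.
case: n Sn nJ => [|n] Sn nJ.
  exists [ffun i : 'I_0 => match i with Ordinal _ p => False_rect J (notF p) end].
    by case.
  by move=> j; rewrite leqn0 cards_eq0 in Sn; rewrite (eqP Sn) inE.
have /card_gt0P[j0 _] : (0 < #|J|)%N by exact: leq_trans nJ.
exists [ffun b : 'I_n.+1 => nth j0 s b].
  move=> a b; rewrite !ffunE => /eqP.
  by rewrite nth_uniq ?ss ?(leq_trans _ nJ) // => /eqP /val_inj.
move=> j jS.
have js : (index j (enum S) < #|S|)%N by rewrite cardE index_mem mem_enum.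
have jn : (index j (enum S) < n.+1)%N by exact: leq_trans js Sn.
exists (Ordinal jn); rewrite ffunE /= nth_cat -cardE js nth_index //.
by rewrite mem_enum.
Qed.

(** Move each point u j along a segment towards the point of parameter t j on
    the moment curve.  Affine dependence of d + 1 of the points is the
    vanishing of a determinant, a polynomial in the parameter s of the
    segment.  At s = 1 it is a Vandermonde determinant, so it has finitely
    many zeros, and arbitrarily small s avoid the zeros of all of them. *)
Lemma general_position_ord (J : finType) (d : nat) (u : J -> 'I_d -> R) (del : R) :
    0 < del <= 1 -> (d < #|J|)%N -> (forall j a, 0 <= u j a <= 1) ->
  exists v : J -> 'I_d -> R, [/\ forall j a, 0 <= v j a <= 1,
    forall j a, `|v j a - u j a| <= del
    & forall c : J -> R, (#|[pred j | c j != 0%R]| <= d.+1)%N ->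
      \sum_j c j = 0 -> (forall a, \sum_j c j * v j a = 0) -> forall j, c j = 0].
Proof.
move=> /andP[del0 del1] dJ u01.
pose t (j : J) : R := (enum_rank j)%:R / #|J|%:R.
have J0 : 0 < #|J|%:R :> R by rewrite ltr0n; exact: leq_ltn_trans dJ.
have t01 j : 0 <= t j <= 1.
  by rewrite divr_ge0 //= ler_pdivrMr // mul1r ler_nat ltnW.
have t_inj : injective t.
  move=> i j /(mulIf _) E; apply/enum_rank_inj/val_inj/eqP.
  by rewrite -(eqr_nat R) E // invr_eq0 gt_eqF.
(* Homogeneous coordinates: the row 0 of ones encodes the condition that the
   coefficients sum to 0, and is the power 0 on the moment curve. *)
pose U j (a : 'I_d.+1) : R := if unlift ord0 a is Some b then u j b else 1.
pose E j (a : 'I_d.+1) : {poly R} := (U j a)%:P + 'X * (t j ^+ a - U j a)%:P.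
have EE j a s : (E j a).[s] = (1 - s) * U j a + s * t j ^+ a.
  by rewrite /E !hornerE; ring.
pose q (sg : {ffun 'I_d.+1 -> J}) : {poly R} := \det (\matrix_(a, b) E (sg b) a).
have qE sg s : (q sg).[s] = \det (\matrix_(a, b) ((1 - s) * U (sg b) a + s * t (sg b) ^+ a)).
  rewrite -/(horner_eval s (q sg)) /q -det_map_mx; congr (\det _).
  by apply/matrixP => a b; rewrite !mxE /= /horner_eval EE.
have q0 (sg : {ffun 'I_d.+1 -> J}) : injective sg -> q sg != 0.
  move=> sgi; apply/eqP => q0; have := qE sg 1; rewrite q0 horner0.
  rewrite (_ : \matrix_(a, b) _ = Vandermonde d.+1 (\row_b t (sg b))); last first.
    by apply/matrixP => a b; rewrite !mxE subrr mul0r add0r mul1r.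
  rewrite det_Vandermonde => /esym/eqP; apply/negP.
  apply/prodf_neq0 => i _; apply/prodf_neq0 => j ij; rewrite !mxE subr_eq0.
  by apply/eqP => /t_inj/sgi ji; rewrite ji ltnn in ij.
pose Q := \prod_(sg : {ffun 'I_d.+1 -> J} | injectiveb sg) q sg.
have Q0 : Q != 0 by apply/prodf_neq0 => sg /injectiveP; exact: q0.
have [s /andP[s0 sd] Qs] := poly_nonroot Q0 del0.
have conv (x y : R) : 0 <= x <= 1 -> 0 <= y <= 1 -> 0 <= (1 - s) * x + s * y <= 1.
  move=> /andP[x0 x1] /andP[y0 y1]; have s1 : 0 <= 1 - s by lra.
  rewrite addr_ge0 ?mulr_ge0 ?(ltW s0) //=.
  have := ler_wpM2l s1 x1; have := ler_wpM2l (ltW s0) y1; lra.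
have tp01 j a : 0 <= t j ^+ a <= 1.
  by have /andP[h0 h1] := t01 j; rewrite exprn_ge0 //= exprn_ile1.
exists (fun j a => (1 - s) * u j a + s * t j ^+ (lift ord0 a)); split.
- by move=> j a; apply: conv.
- move=> j a; have /andP[u0 u1] := u01 j a.
  rewrite (_ : _ - _ = s * (t j ^+ (lift ord0 a) - u j a)); last by ring.
  rewrite normrM gtr0_norm //; apply: le_trans sd; rewrite ler_piMr ?(ltW s0) //.
  by have /andP[h0 h1] := tp01 j (lift ord0 a); rewrite ler_norml; lra.
move=> c cd csum cv.
have dJ' : (d.+1 <= #|J|)%N by [].
have cardS : (#|[set j | c j != 0%R]%SET| <= d.+1)%N by rewrite cardsE.
have [sg sgi sgS] := enum_superset cardS dJ'.
have qs : (q sg).[s] != 0.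
  move: Qs; rewrite /Q horner_prod => /prodf_neq0; apply; exact/injectiveP.
pose M := \matrix_(a, b) ((1 - s) * U (sg b) a + s * t (sg b) ^+ a).
have Mu : M \in unitmx by rewrite unitmxE unitfE -qE.
have red (g : J -> R) : \sum_j c j * g j = \sum_b c (sg b) * g (sg b).
  rewrite -(big_imset (fun j => c j * g j) (h := sg) (A := predT)) /=; last by move=> ? ? _ _; exact: sgi.
  rewrite [LHS](bigID [in sg @: predT]) /= [X in _ + X]big1 ?addr0 // => j jn.
  rewrite (_ : c j = 0) ?mul0r //; apply/eqP; apply: contraNT jn => cj.
  have [|b ->] := sgS j; first by rewrite inE.
  by apply/imsetP; exists b.
have Mc : M *m \col_b c (sg b) = 0.
  apply/matrixP => a z; rewrite !mxE.
  transitivity (\sum_j c j * ((1 - s) * U j a + s * t j ^+ a)).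
    by rewrite red; apply: eq_bigr => b _; rewrite !mxE mulrC.
  have [b ->|->] := unliftP ord0 a.
    by rewrite -[RHS](cv b); apply: eq_bigr => j _; rewrite /U liftK.
  rewrite -[RHS]csum; apply: eq_bigr => j _.
  by rewrite /U unlift_none expr0 !mulr1 subrK mulr1.
have c0 : \col_b c (sg b) = 0 by rewrite -(mulKmx Mu (\col_b c (sg b))) Mc mulmx0.
move=> j; apply/eqP; apply: contraT => cj.
have [|b jb] := sgS j; first by rewrite inE.
by have := congr1 (fun z : 'cV_(d.+1) => z b ord0) c0; rewrite !mxE -jb => /eqP; rewrite (negbTE cj).
Qed.

(** The points are completed by |D| + 1 dummy ones, so that every small set of
    indices is contained in one of exactly |D| + 1 elements. *)
Lemma general_position (I D : finType) (u : I -> D -> R) (del : R) :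
    0 < del -> (forall i a, 0 <= u i a <= 1) ->
  exists v : I -> D -> R, [/\ forall i a, 0 <= v i a <= 1,
    forall i a, `|v i a - u i a| <= del
    & forall c : I -> R, (#|[pred i | c i != 0%R]| <= #|D|.+1)%N ->
      \sum_i c i = 0 -> (forall a, \sum_i c i * v i a = 0) -> forall i, c i = 0].
Proof.
move=> del0 u01.
pose J : finType := (I + 'I_#|D|.+1)%type.
pose uJ (j : J) (a : 'I_#|D|) : R := if j is inl i then u i (enum_val a) else 0.
have [|||v [v01 vu vg]] := @general_position_ord J #|D| uJ (Num.min del 1).
- by rewrite lt_min del0 ltr01 /= ge_min lexx orbT.
- by rewrite card_sum card_ord addnS ltnS leq_addl.
- by case=> [i|z] a /=; rewrite ?u01 // lexx ler01.
exists (fun i a => v (inl i) (enum_rank a)); split=> [//|i a|c cd csum cv i].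
  have := vu (inl i) (enum_rank a); rewrite /uJ enum_rankK => h.
  by apply: le_trans h _; rewrite ge_min lexx.
pose cJ (j : J) : R := if j is inl i then c i else 0.
apply: (vg cJ _ _ _ (inl i)).
- apply: leq_trans cd; rewrite -(fintype.card_image (@inl_inj I 'I_#|D|.+1)).
  apply/subset_leq_card/fintype.subsetP => -[j|z]; rewrite inE /= ?eqxx // => cj.
  by apply/fintype.imageP; exists j.
- by rewrite big_sumType /= [X in _ + X]big1 ?addr0.
- move=> a; rewrite big_sumType /= [X in _ + X]big1 ?addr0 => [|z _]; last exact: mul0r.
  by rewrite -[RHS](cv (enum_val a)); apply: eq_bigr => j _; rewrite enum_valK.
Qed.

End general_position.

Section nerve_map.
Variables (R : realType) (k : nat) (X : metricType R) (T : Zk_action k X).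

(** Send x to the barycentre of points v i in general position, weighted by a
    partition of unity.  If x and y have the same image, the differences of
    their weights are an affine dependence between at most 2 (m + 1) of the
    v i, hence vanish, so x and y lie in a common member of the cover.  If
    v i is near the orbit piece of f at a point of the member i, then F stays
    near f. *)
Lemma nerve_map (H : finType) (be : H -> 'rV[int]_k) (L m : nat) (eps del : R)
    (f : 'I_L -> X -> R) :
    0 < del -> weights T (range be) eps m -> (2 * m + 1 <= L * #|H|)%N ->
    (forall l x, 0 <= f l x <= 1) ->
    (forall l x y, mdist x y <= eps -> `|f l x - f l y| <= del) ->
  exists F : H -> 'I_L -> X -> R, [/\ forall h l, continuous (F h l),
    forall h l x, 0 <= F h l x <= 1,
    forall h l x, `|F h l x - f l (T (be h) x)| <= del + del
    & forall x y, (forall h l, F h l x = F h l y) ->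
        forall h, mdist (T (be h) x) (T (be h) y) <= eps].
Proof.
move=> del0 [I [phi [cphi phi0 phiex phieps phim]]] mL f01 feps.
have /choice[c cP] : forall i, exists o : option X, forall x, 0 < phi i x ->
    exists2 z, o = Some z & 0 < phi i z.
  move=> i; have [[z zi]|n] := pselect (exists z, 0 < phi i z).
    by exists (Some z) => x _; exists z.
  by exists None => x xi; exfalso; apply: n; exists x.
pose u (i : I) (hl : H * 'I_L) : R := if c i is Some z then f hl.2 (T (be hl.1) z) else 0.
have u01 i hl : 0 <= u i hl <= 1.
  by rewrite /u; case: (c i) => [z|]; rewrite ?f01 // lexx ler01.
have [v [v01 vu vg]] := general_position del0 u01.
pose S x := \sum_i phi i x.
have S0 x : 0 < S x.
  have [i fi] := phiex x; rewrite /S (bigD1 i) //=.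
  by apply: lt_le_trans fi _; rewrite lerDl sumr_ge0.
have cS : continuous S by exact: continuous_sum.
pose psi i x := phi i x / S x.
have cpsi i : continuous (psi i).
  move=> x; apply: cvgM; first exact: cphi.
  by apply: cvgV; [exact: lt0r_neq0 | exact: cS].
have psi0 i x : 0 <= psi i x by rewrite divr_ge0 // ltW.
have psi_gt0 i x : (0 < psi i x) = (0 < phi i x).
  by rewrite pmulr_lgt0 // invr_gt0.
have psi1 x : \sum_i psi i x = 1 by rewrite /psi -mulr_suml -/(S x) divff // lt0r_neq0.
exists (fun h l x => \sum_i psi i x * v i (h, l)); split.
- move=> h l; apply: continuous_sum => i x; apply: cvgM; last exact: cvg_cst.
  exact: cpsi.
- move=> h l x; rewrite sumr_ge0 /=; last first.
    by move=> i _; rewrite mulr_ge0 //; have /andP[] := v01 i (h, l).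
  rewrite -(psi1 x); apply: ler_sum => i _; rewrite ler_piMr //.
  by have /andP[] := v01 i (h, l).
- move=> h l x; rewrite -[f l _]mul1r -(psi1 x) mulr_suml -sumrB.
  apply: le_trans (ler_norm_sum _ _ _) _.
  rewrite -[leRHS]mul1r -(psi1 x) mulr_suml; apply: ler_sum => i _.
  rewrite -mulrBr normrM ger0_norm //.
  have [p0|p0] := lerP (psi i x) 0.
    have -> : psi i x = 0 by apply/eqP; rewrite eq_le p0 psi0.
    by rewrite !mul0r.
  rewrite ler_wpM2l //; rewrite psi_gt0 in p0.
  have [z cz zi] := cP i x p0.
  rewrite (_ : _ - _ = (v i (h, l) - u i (h, l)) + (u i (h, l) - f l (T (be h) x))).
    apply: le_trans (ler_normD _ _) _; apply: lerD; first exact: vu.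
    by rewrite /u cz /=; apply: feps; apply: (phieps i) => //; exists h.
  by ring.
- move=> x y Fxy h; have [i xi] := phiex x.
  have : forall i, psi i x - psi i y = 0.
    apply: vg.
    + apply: leq_trans (_ : #|[predU [pred i | (0 < phi i x)%R] & [pred i | (0 < phi i y)%R]]| <= _)%N.
        apply/subset_leq_card/fintype.subsetP => j; rewrite !inE -!psi_gt0.
        apply: contraNT; rewrite negb_or -!leNgt => /andP[A B].
        have -> : psi j x = 0 by apply/eqP; rewrite eq_le A psi0.
        have -> : psi j y = 0 by apply/eqP; rewrite eq_le B psi0.
        by rewrite subrr.
      apply: leq_trans (leq_addr #|[predI [pred i | (0 < phi i x)%R] & [pred i | (0 < phi i y)%R]]| _) _.
      rewrite cardUI; apply: leq_trans (leq_add (phim x) (phim y)) _.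
      rewrite card_prod card_ord; lia.
    + by rewrite sumrB !psi1 subrr.
    + move=> [h' l]; rewrite -[RHS](subrr (\sum_i psi i x * v i (h', l))).
      rewrite [X in _ = _ - X](Fxy h' l) -sumrB; apply: eq_bigr => j _; rewrite mulrBl //.
  move=> /(_ i) /eqP; rewrite subr_eq0 => /eqP E.
  apply: (phieps i) => //.
  by rewrite -psi_gt0 -E psi_gt0.
Qed.

End nerve_map.

(** * Perturbing an observable along towers *)

Section perturbation.
Variables (R : realType) (k : nat) (X : metricType R) (T : Zk_action k X).
Hypothesis cX : compact [set: X].
Variables (Y : Type) (p : X -> Y).
Hypothesis pT : forall g x y, p x = p y -> p (T g x) = p (T g y).

(** Tolerance eta in the orbits makes this property pass to every function
    that is closer than eta to f, up to a smaller tolerance. *)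
Definition separates (E : Type) (f : E -> X -> R) (eps eta : R) : Prop :=
  forall x y, p x = p y ->
    (forall e g, `|f e (T g x) - f e (T g y)| <= eta) -> mdist x y <= eps.

Lemma actNK g x : T (- g) (T g x) = x.
Proof. by rewrite -actD addNr act0. Qed.

Lemma actKN g x : T g (T (- g) x) = x.
Proof. by rewrite -actD addrN act0. Qed.

Lemma pos_lower_bound (C : finType) (r : C -> R) : (forall c, 0 < r c) ->
  exists2 d, 0 < d & forall c, d <= r c.
Proof.
move=> r0; exists (\big[Num.min/1]_c r c).
  by apply: lt_bigmin => // c _; exact: r0.
by move=> c; exact: bigmin_le.
Qed.

(** On the level h of the tower c, the function f is blended into the
    coordinate h of the nerve map F c evaluated at the base point
    T (- be h) x.  Levels are disjoint, so f' stays in [0, 1] and near f.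
    Where Phi c is 1 at the base point z, the values of f' along the orbit
    piece of z are all the coordinates of F c at z.  Points of one fibre are
    on the same level of the same tower, so equality of their f'-orbits gives
    equality under F c, and then closeness along the whole piece. *)
Lemma perturb (C H : finType) (be : H -> 'rV[int]_k) (Phi : C -> X -> R)
    (L m : nat) (eps del : R) (f : C * 'I_L -> X -> R) :
    0 < eps -> 0 < del ->
    (forall c, continuous (Phi c)) -> (forall c x, 0 <= Phi c x <= 1) ->
    (forall c x y, p x = p y -> Phi c x = Phi c y) ->
    (forall c x h h', h != h' ->
       Phi c (T (- be h) x) * Phi c (T (- be h') x) = 0) ->
    (forall x, exists c h, Phi c (T (- be h) x) = 1) ->
    weights T (range be) eps m -> (2 * m + 1 <= L * #|H|)%N ->
    (forall e, continuous (f e)) -> (forall e x, 0 <= f e x <= 1) ->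
    (forall e x y, mdist x y <= eps -> `|f e x - f e y| <= del) ->
  exists2 f' : C * 'I_L -> X -> R,
    [/\ forall e, continuous (f' e), forall e x, 0 <= f' e x <= 1
      & forall e x, `|f' e x - f e x| <= del + del]
    & exists2 eta, 0 < eta & separates f' (eps + eps) eta.
Proof.
move=> eps0 del0 cPhi Phi01 Phip Phi_dis Phi_cov wT mL cf f01 fu.
have /choice[F FP] : forall c, exists F : H -> 'I_L -> X -> R,
   [/\ forall h l, continuous (F h l), forall h l x, 0 <= F h l x <= 1,
    forall h l x, `|F h l x - f (c, l) (T (be h) x)| <= del + del
    & forall x y, (forall h l, F h l x = F h l y) ->
        forall h, mdist (T (be h) x) (T (be h) y) <= eps].
  move=> c; apply: (nerve_map (f := fun l => f (c, l)) del0 wT mL) => l.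
    exact: f01.
  exact: fu.
pose f' (e : C * 'I_L) x := f e x +
  \sum_h Phi e.1 (T (- be h) x) * (F e.1 h e.2 (T (- be h) x) - f e x).
have f'E e x h : Phi e.1 (T (- be h) x) != 0 -> f' e x = f e x +
    Phi e.1 (T (- be h) x) * (F e.1 h e.2 (T (- be h) x) - f e x).
  move=> nz; rewrite /f' (bigD1 h) //= big1 ?addr0 // => h' h'h.
  have /eqP := Phi_dis e.1 x h' h h'h; rewrite mulf_eq0 (negbTE nz) orbF.
  by move=> /eqP ->; rewrite mul0r.
have f'_val e x : f' e x = f e x \/ exists h, f' e x = f e x +
    Phi e.1 (T (- be h) x) * (F e.1 h e.2 (T (- be h) x) - f e x).
  have [[h nz]|n] := pselect (exists h, Phi e.1 (T (- be h) x) != 0).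
    by right; exists h; exact: f'E.
  left; rewrite /f' big1 ?addr0 // => h _.
  have [->|nz] := eqVneq (Phi e.1 (T (- be h) x)) 0; first by rewrite mul0r.
  by exfalso; apply: n; exists h.
have Feq c h l z : Phi c z = 1 -> f' (c, l) (T (be h) z) = F c h l z.
  move=> Pz; rewrite (f'E _ _ h) /= actNK Pz ?oner_neq0 //; ring.
exists f'.
  split.
  - move=> e x; apply: cvgD; first exact: cf.
    apply: (continuous_sum (f := fun h x => Phi e.1 (T (- be h) x) *
      (F e.1 h e.2 (T (- be h) x) - f e x))) => h {}x.
    have cT := @act_continuous _ _ T (- be h).
    apply: cvgM.
      by apply: (@continuous_comp _ _ _ (T (- be h)) (Phi e.1)); [exact: cT|exact: cPhi].
    apply: cvgB; last exact: cf.
    have [cF _ _ _] := FP e.1.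
    by apply: (@continuous_comp _ _ _ (T (- be h)) (F e.1 h e.2)); [exact: cT|exact: cF].
  - move=> e x; have [->|[h ->]] := f'_val e x; first exact: f01.
    have [_ F01 _ _] := FP e.1.
    have /andP[P0 P1] := Phi01 e.1 (T (- be h) x).
    have /andP[F0 F1] := F01 h e.2 (T (- be h) x).
    have /andP[g0 g1] := f01 e x.
    set P := Phi _ _ in P0 P1 *; set G := F _ _ _ _ in F0 F1 *.
    rewrite (_ : _ + _ = (1 - P) * f e x + P * G); last by ring.
    have P1' : 0 <= 1 - P by lra.
    rewrite addr_ge0 ?mulr_ge0 //=.
    have := ler_wpM2l P1' g1; have := ler_wpM2l P0 F1; lra.
  - move=> e x; have [->|[h ->]] := f'_val e x.
      by rewrite subrr normr0; lra.
    have [_ _ Fd _] := FP e.1.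
    have := Fd h e.2 (T (- be h) x); rewrite actKN -surjective_pairing => le.
    have /andP[P0 P1] := Phi01 e.1 (T (- be h) x).
    rewrite addrAC subrr add0r normrM ger0_norm //; apply: le_trans le.
    by rewrite ler_piMl.
pose dF c (zw : X * X) := \big[Num.max/0]_(hl : H * 'I_L)
  `|F c hl.1 hl.2 zw.1 - F c hl.1 hl.2 zw.2|.
pose dT (zw : X * X) := \big[Num.max/0]_h mdist (T (be h) zw.1) (T (be h) zw.2).
have cfst : continuous (fst : X * X -> X) by move=> z; exact: cvg_fst.
have csnd : continuous (snd : X * X -> X) by move=> z; exact: cvg_snd.
have cdT : continuous dT.
  apply: continuous_bigmax => h.
  have cT := @act_continuous _ _ T (be h).
  apply: (continuous_mdist (f := fun zw => T (be h) zw.1) (g := fun zw => T (be h) zw.2)).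
    by move=> z; apply: (@continuous_comp _ _ _ fst (T (be h))); [exact: cfst|exact: cT].
  by move=> z; apply: (@continuous_comp _ _ _ snd (T (be h))); [exact: csnd|exact: cT].
have cdF c : continuous (dF c).
  apply: continuous_bigmax => -[h l] z /=; apply: cvg_norm.
  have [cF _ _ _] := FP c.
  apply: cvgB.
    by apply: (@continuous_comp _ _ _ fst (F c h l)); [exact: cfst|exact: cF].
  by apply: (@continuous_comp _ _ _ snd (F c h l)); [exact: csnd|exact: cF].
have cXX : compact [set: X * X].
  by rewrite -setXTT; exact: compact_setX.
have /choice[eta etaP] : forall c, exists eta, 0 < eta /\
    forall z, dF c z <= eta -> dT z < eps + eps.
  move=> c; have [|eta eta0 etaP] := compact_imply (e := eps + eps) cXX (cdF c) cdT.
    move=> [z w] dF0; apply: (@le_lt_trans _ _ eps); last by lra.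
    apply: bigmax_le => [|h _]; first exact: ltW.
    have [_ _ _ Finj] := FP c; apply: Finj => {}h l.
    apply/eqP; rewrite -subr_eq0 -normr_le0; apply: le_trans dF0.
    pose G (hl : H * 'I_L) := `|F c hl.1 hl.2 z - F c hl.1 hl.2 w|.
    exact: (@le_bigmax _ _ _ 0 G (h, l)).
  by exists eta.
have [eta0 eta00 eta0P] := pos_lower_bound (fun c => (etaP c).1).
exists eta0 => // x y pxy xy.
have [c [h0 Px]] := Phi_cov x.
pose z := T (- be h0) x; pose w := T (- be h0) y.
have Pw : Phi c w = 1 by rewrite -Px; apply/esym/Phip/pT.
have : dT (z, w) < eps + eps.
  apply: (etaP c).2; apply: bigmax_le => [|[h l] _ /=]; first exact: ltW (etaP c).1.
  apply: le_trans (eta0P c); rewrite -!Feq // /z /w -!actD.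
  exact: xy.
move=> /ltW; apply: le_trans; rewrite -[x in leLHS](actKN (be h0)) -[y in leLHS](actKN (be h0)).
pose G h := mdist (T (be h) z) (T (be h) w).
exact: (@le_bigmax _ _ _ 0 G h0).
Qed.

End perturbation.

(** * Towers over the torus *)

Section circle_functions.
Local Open Scope quotient_scope.
Variable R : realType.

Lemma periodic_eq (phi : R -> R) (s t : R) :
  (forall t (n : int), phi (t + n%:~R) = phi t) ->
  \pi_(circle R) s = \pi_(circle R) t -> phi s = phi t.
Proof.
move=> per /pi_circle_eq /intrP[n st].
by rewrite -(per t n) -st addrC subrK.
Qed.

Lemma periodic_circle_continuous (phi : R -> R) :
  continuous phi -> (forall t (n : int), phi (t + n%:~R) = phi t) ->
  continuous (fun c : circle R => phi (repr c)).
Proof.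
move=> cphi per; apply/quotient_continuous.
rewrite [X in continuous X](_ : _ = phi) //; apply/funext => t /=.
by apply: periodic_eq => //; rewrite reprK.
Qed.

Lemma periodic_circleD (phi : R -> R) (c : circle R) (t : R) :
  (forall t (n : int), phi (t + n%:~R) = phi t) ->
  phi (repr (c + \pi_(circle R) t)) = phi (repr c + t).
Proof.
by move=> per; apply: periodic_eq => //; rewrite reprK pi_circleD reprK.
Qed.

Variables (k : nat) (alpha : 'I_k -> R).
Hypothesis ira : forall i, irrational (alpha i).
Variables (X : topologicalType) (T : Zk_action k X) (p : X -> torus R k).
Hypotheses (cp : continuous p) (pT : equivariant T (rotation alpha) p).

Lemma coordinate_continuous (phi : R -> R) (i : 'I_k) :
  continuous phi -> (forall t (n : int), phi (t + n%:~R) = phi t) ->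
  continuous (fun x => phi (repr (p x i))).
Proof.
move=> cphi per x.
apply: (@continuous_comp _ _ _ (fun x => p x i) (fun c : circle R => phi (repr c))).
  apply: (@continuous_comp _ _ _ p (fun y : torus R k => y i)); first exact: cp.
  exact: ptws_proj_continuous.
exact: periodic_circle_continuous.
Qed.

Lemma coordinate_act (phi : R -> R) (i : 'I_k) g x :
  (forall t (n : int), phi (t + n%:~R) = phi t) ->
  phi (repr (p (T g x) i)) = phi (repr (p x i) + (g ord0 i)%:~R * alpha i).
Proof. by move=> per; rewrite pT /= /rotation_fun periodic_circleD. Qed.

(** Products of circle towers: two different elements of the box differ in some
    coordinate, where the two levels are already disjoint.  The heights N i
    are record return times of alpha i and differ from one coordinate to
    another. *)
Lemma torus_towers (M : nat) : exists N : 'I_k -> nat,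
  (forall i, M <= N i)%N /\
  let be (h : {dffun forall i, 'I_(N i)}) : 'rV[int]_k := \row_i (h i)%:Z in
  exists Phi : {ffun 'I_k -> bool} -> X -> R,
  [/\ forall c, continuous (Phi c), forall c x, 0 <= Phi c x <= 1,
    forall c x y, p x = p y -> Phi c x = Phi c y,
    forall c x h h', h != h' ->
       Phi c (T (- be h) x) * Phi c (T (- be h') x) = 0
    & forall x, exists c h, Phi c (T (- be h) x) = 1].
Proof.
have /choice[N /choice[phi NP]] := fun i => circle_towers M (@ira i).
exists N; split; first by move=> i; have [/ltnW] := NP i.
move=> be.
pose Phi (c : {ffun 'I_k -> bool}) x := \prod_i phi i (c i) (repr (p x i)).
have Phi_act c h x : Phi c (T (- be h) x) =
    \prod_i phi i (c i) (repr (p x i) - (h i)%:R * alpha i).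
  apply: eq_bigr => i _; have [_ _ per _ _] := NP i.
  by rewrite coordinate_act // !mxE mulrNz mulNr.
exists Phi; split.
- move=> c; apply: continuous_prod => i; have [_ cphi per _ _] := NP i.
  exact: coordinate_continuous.
- move=> c x; apply/andP; split.
    by apply: prodr_ge0 => i _; have [_ _ _ /(_ (c i)) phi01 _] := NP i; case/andP: (phi01 (repr (p x i))).
  apply: prodr_ile1 => i _; have [_ _ _ + _] := NP i; exact.
- by move=> c x y pxy; rewrite /Phi pxy.
- move=> c x h h' hh'; rewrite !Phi_act -big_split /=.
  have [i hi] : exists i, h i != h' i.
    apply: contrapT => nex; move/eqP: hh'; apply; apply/ffunP => i.
    by apply/eqP; apply: contrapT => /negP hi; apply: nex; exists i.
  rewrite (bigD1 i) //=; have [_ _ _ _ [dis _]] := NP i.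
  by rewrite dis ?mul0r.
- move=> x.
  have tower i : exists bh : bool * 'I_(N i),
      phi i bh.1 (repr (p x i) - bh.2%:R * alpha i) = 1.
    have [_ _ _ _ [_ /(_ (repr (p x i)))[b [h hN hE]]]] := NP i.
    by exists (b, Ordinal hN).
  pose bh i := sval (cid (tower i)).
  exists [ffun i => (bh i).1], [ffun i => (bh i).2]; rewrite Phi_act.
  by apply: big1 => i _; rewrite !ffunE; exact: svalP (cid (tower i)).
Qed.

End circle_functions.

(** * Passing to the limit *)

Section limit.
Variables (R : realType) (k : nat) (X : metricType R) (T : Zk_action k X).
Variables (Y : Type) (p : X -> Y) (E : finType).

Definition unit_valued (f : E -> X -> R) : Prop :=
  (forall e, continuous (f e)) /\ (forall e x, 0 <= f e x <= 1).

(** A Baire category argument made explicit.  The sequence F n is constructed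
    together with radii d n that at least halve at each step, with F n.+1
    within d n / 2 of F n.  Then the limit is within d n of F n for each n,
    and F n.+1 separates with a tolerance 2 d n.+1, enough for the limit. *)
Lemma separating_limit :
    (forall f eps del, unit_valued f -> 0 < eps -> 0 < del ->
       exists f' eta, [/\ unit_valued f', forall e x, `|f' e x - f e x| <= del,
         0 < eta & separates T p f' eps eta]) ->
  exists2 f : E -> X -> R, unit_valued f &
    forall x y, p x = p y -> (forall e g, f e (T g x) = f e (T g y)) -> x = y.
Proof.
move=> dense.
pose St : Type := ((E -> X -> R) * R)%type.
have next (n : nat) (s : St) : exists s' : St, unit_valued s.1 -> 0 < s.2 ->
    [/\ unit_valued s'.1, forall e x, `|s'.1 e x - s.1 e x| <= s.2 / 2,
      0 < s'.2, s'.2 <= s.2 / 2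
      & separates T p s'.1 n.+1%:R^-1 (s'.2 + s'.2)].
  have [[us s0]|nus] := pselect (unit_valued s.1 /\ 0 < s.2); last first.
    by exists s => us s0; exfalso; apply: nus.
  have n0 : 0 < n.+1%:R^-1 :> R by rewrite invr_gt0 ltr0n.
  have s20 : 0 < s.2 / 2 by rewrite divr_gt0.
  have [f' [eta [uf' f'f eta0 sep]]] := dense s.1 _ _ us n0 s20.
  exists (f', Num.min (s.2 / 2) (eta / 2)) => _ _ /=; split=> //.
  - by rewrite lt_min s20 divr_gt0.
  - by rewrite ge_min lexx.
  - move=> x y pxy xy; apply: (sep x y pxy) => e g; apply: le_trans (xy e g) _.
    have : Num.min (s.2 / 2) (eta / 2) <= eta / 2 by rewrite ge_min lexx orbT.
    lra.
have /choice[nx0 nxP0] : forall ns : nat * St, exists s' : St,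
    unit_valued ns.2.1 -> 0 < ns.2.2 ->
    [/\ unit_valued s'.1, forall e x, `|s'.1 e x - ns.2.1 e x| <= ns.2.2 / 2,
      0 < s'.2, s'.2 <= ns.2.2 / 2
      & separates T p s'.1 ns.1.+1%:R^-1 (s'.2 + s'.2)].
  by move=> [n s]; exact: next.
pose st := fix st (n : nat) : St :=
  if n is m.+1 then nx0 (m, st m) else (fun _ _ => 0, 1).
pose F n := (st n).1; pose d n := (st n).2.
have good n : unit_valued (F n) /\ 0 < d n.
  elim: n => [|n [un dn]].
    split=> //; split=> [e x|e x]; first exact: cvg_cst.
    by rewrite lexx ler01.
  by have [] := nxP0 (n, st n) un dn.
have step n : [/\ forall e x, `|F n.+1 e x - F n e x| <= d n / 2,
    d n.+1 <= d n / 2 & separates T p (F n.+1) n.+1%:R^-1 (d n.+1 + d n.+1)].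
  have [un dn] := good n; by have [_ ? _ ? ?] := nxP0 (n, st n) un dn; split.
have close m n e x : `|F (m + n)%N e x - F m e x| <= d m - d (m + n)%N.
  elim: n => [|n IH]; first by rewrite addn0 !subrr normr0.
  rewrite addnS; have [/(_ e x) h1 h2 _] := step (m + n)%N.
  have := ler_normD (F (m + n).+1 e x - F (m + n)%N e x) (F (m + n)%N e x - F m e x).
  rewrite addrA subrK; lra.
have bounds m n e x : F m e x - d m <= F n e x + d n.
  have dm := (good m).2; have dn := (good n).2.
  have [mn|nm] := leqP m n.
    have := close m (n - m)%N e x; rewrite subnKC // ler_norml => /andP[]; lra.
  have := close n (m - n)%N e x; rewrite subnKC ?(ltnW nm) // ler_norml => /andP[]; lra.
(* The intervals F n e x +- d n pairwise intersect, and f e x is the infimum of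
   their right ends, hence lies in all of them. *)
pose S e x : set R := [set F n e x + d n | n in [set: nat]].
pose f e x := inf (S e x).
have fF n e x : `|f e x - F n e x| <= d n.
  rewrite ler_norml; apply/andP; split.
    rewrite lerBrDl -[_ + - _]/(F n e x - d n).
    apply: lb_le_inf; first by exists (F 0%N e x + d 0%N); exists 0%N.
    by move=> _ [m _ <-]; exact: bounds.
  rewrite lerBlDl; apply: ge_inf; last by exists n.
  by exists (F n e x - d n) => _ [m _ <-]; exact: bounds.
have d_small e0 : 0 < e0 -> exists n, d n < e0.
  move=> e00.
  have dle n : d n * n.+1%:R <= d 0%N.
    elim: n => [|n IH]; first by rewrite mulr1.
    have [_ h _] := step n; have dn := (good n).2.
    apply: le_trans IH; apply: le_trans (ler_wpM2r _ h) _ => //.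
    rewrite -mulrA; apply: ler_wpM2l; first exact: ltW.
    rewrite mulrC ler_pdivrMr // -natrM ler_nat; lia.
  pose n := Num.bound (d 0%N / e0); exists n.
  have := archi_boundP (divr_ge0 (ltW (good 0%N).2) (ltW e00)).
  rewrite -/n ltr_pdivrMr // => A.
  rewrite -(ltr_pM2r (ltr0Sn R n)); apply: le_lt_trans (dle n) _.
  apply: lt_trans A _; rewrite mulrC ltr_pM2l // ltr_nat //.
exists f.
  split=> [e x|e x]; last first.
    apply/andP; split; apply/ler_addgt0Pl => e0 /d_small[n dn].
      have [[_ /(_ e x)/andP[F0 _]] _] := good n.
      have := fF n e x; rewrite ler_norml => /andP[]; lra.
    have [[_ /(_ e x)/andP[_ F1]] _] := good n.
    have := fF n e x; rewrite ler_norml => /andP[]; lra.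
  apply/cvgrPdist_lt => e0 e00.
  have [|n dn] := d_small (e0 / 3); first by rewrite divr_gt0.
  have cF := (good n).1.1 e.
  have e03 : 0 < e0 / 3 by rewrite divr_gt0.
  near=> y.
  have xy : `|F n e x - F n e y| < e0 / 3.
    near: y.
    have := cF x.
    by move=> /cvgrPdist_lt/(_ _ e03).
  have := fF n e x; have := fF n e y; move: xy; rewrite !ler_norml !ltr_norml.
  by move=> /andP[? ?] /andP[? ?] /andP[? ?]; apply/andP; split; lra.
move=> x y pxy xy; apply: mdist_positivity; apply/eqP; rewrite eq_le mdist_ge0 andbT.
apply/ler_addgt0Pl => e0 e00; rewrite addr0.
pose n := Num.bound e0^-1.
have e0V : 0 <= e0^-1 by rewrite invr_ge0 ltW.
have nP : n.+1%:R^-1 <= e0.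
  rewrite -[e0]invrK lef_pV2 ?posrE ?invr_gt0 ?ltr0n //.
  apply: ltW; apply: lt_le_trans (archi_boundP e0V) _; rewrite ler_nat //.
apply: le_trans nP; have [_ _ sep] := step n; apply: sep => // e g.
have := fF n.+1 e (T g x); have := fF n.+1 e (T g y); rewrite xy !ler_norml.
by move=> /andP[? ?] /andP[? ?]; apply/andP; split; lra.
Unshelve. all: by end_near. Qed.

End limit.

(** * The embedding *)

Section embedding.
Variables (R : realType) (k : nat).

Lemma embeds_full_shift (X : topologicalType) (T : Zk_action k X) (J : finType)
    (N : nat) (f : J -> X -> R) :
    #|J| = N -> (forall j, continuous (f j)) -> (forall j x, 0 <= f j x <= 1) ->
    (forall x y, (forall j g, f j (T g x) = f j (T g y)) -> x = y) ->
  embeds T (full_shift R k N).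
Proof.
move=> <- cf f01 finj.
have fin j x : f j x \in `[0 : R, 1]%classic by rewrite inE /= in_itv /= f01.
pose f' j x : `[0 : R, 1]%classic := SigSub (fin j x).
have cf' j : continuous (f' j).
  apply: continuous_comp_initial => x /=; exact: cf.
exists (fun x => (fun g => (fun i : 'I_#|J| => f' (enum_val i) (T g x))) : full_shift_space R k #|J|); split.
- apply: (@ptws_continuous 'rV[int]_k X (cube R #|J|)) => g.
  apply: (@ptws_continuous 'I_#|J| X `[0 : R, 1]%classic) => i x.
  apply: (@continuous_comp _ _ _ (T g) (f' (enum_val i))).
    exact: act_continuous.
  exact: cf'.
- move=> x y xy; apply: finj => j g.
  have := congr1 (fun u : full_shift_space R k #|J| => val (u g (enum_rank j))) xy.
  by rewrite /= enum_rankK.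
- by move=> g x; apply/funext => h; apply/funext => i /=; rewrite /shift_fun actD.
Qed.

End embedding.

Section assembly.
Variables (R : realType) (k : nat) (X : metricType R) (T : Zk_action k X).
Hypotheses (cX : compact [set: X]) (k0 : (0 < k)%N).

Lemma uniform_modulus (E : finType) (f : E -> X -> R) (del : R) :
  0 < del -> (forall e, continuous (f e)) ->
  exists2 eps, 0 < eps & forall e x y, mdist x y <= eps -> `|f e x - f e y| <= del.
Proof.
move=> del0 cf.
pose D (z : X * X) := \big[Num.max/0]_e `|f e z.1 - f e z.2|.
have cfst : continuous (fst : X * X -> X) by move=> z; exact: cvg_fst.
have csnd : continuous (snd : X * X -> X) by move=> z; exact: cvg_snd.
have cD : continuous D.
  apply: continuous_bigmax => e z /=; apply: cvg_norm; apply: cvgB.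
    by apply: (@continuous_comp _ _ _ fst (f e)); [exact: cfst|exact: cf].
  by apply: (@continuous_comp _ _ _ snd (f e)); [exact: csnd|exact: cf].
have cXX : compact [set: X * X] by rewrite -setXTT; exact: compact_setX.
have [|eps eps0 epsP] := compact_imply (e := del) cXX (continuous_mdist cfst csnd) cD.
  move=> [x y] /= xy; have -> : x = y.
    by apply: mdist_positivity; apply/eqP; rewrite eq_le xy mdist_ge0.
  rewrite /D big1_idem //= => [|e _]; first exact: maxxx.
  by rewrite subrr normr0.
exists eps => // e x y xy.
apply: le_trans (ltW (epsP (x, y) xy)).
pose G e := `|f e x - f e y|; exact: (@le_bigmax _ _ _ 0 G e).
Qed.

Variables (alpha : 'I_k -> R) (p : X -> torus R k).
Hypothesis ira : forall i, irrational (alpha i).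
Hypotheses (cp : continuous p) (pT : equivariant T (rotation alpha) p).

Lemma pT_eq g x y : p x = p y -> p (T g x) = p (T g y).
Proof. by rewrite !pT => ->. Qed.

(** Twice the diameter of the cover has to be at most eps, and f has to vary by
    at most del / 2 on it, hence the choice of eps'. *)
Lemma separates_dense (L : nat) (x0 : X) : (0 < L)%N ->
    (mdim T < (L%:R / 2)%:E)%E ->
  let E := ({ffun 'I_k -> bool} * 'I_L)%type in
  forall (f : E -> X -> R) eps del, unit_valued f -> 0 < eps -> 0 < del ->
    exists f' eta, [/\ unit_valued f', forall e x, `|f' e x - f e x| <= del,
      0 < eta & separates T p f' eps eta].
Proof.
move=> L0 md E f eps del [cf f01] eps0 del0.
have del2 : 0 < del / 2 by rewrite divr_gt0.
have [eps1 eps10 fu] := uniform_modulus del2 cf.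
pose eps' := Num.min (eps / 2) eps1.
have eps'0 : 0 < eps' by rewrite lt_min eps10 divr_gt0.
have [M MP] := mdim_lt_box cX x0 k0 L0 eps'0 md.
have [N [MN [Phi [cPhi Phi01 Phip Phi_dis Phi_cov]]]] := torus_towers ira cp pT M.
have [m mN wT] := MP N MN.
pose H := {dffun forall i, 'I_(N i)}.
have cH : #|{: H}| = (\prod_i N i)%N.
  by rewrite card_dep_ffun foldrE big_map big_enum; apply: eq_bigr => i _; rewrite card_ord.
rewrite box_ffun in wT; rewrite -cH in mN.
have fu' e x y : mdist x y <= eps' -> `|f e x - f e y| <= del / 2.
  by move=> xy; apply: fu; apply: le_trans xy _; rewrite ge_min lexx orbT.
have [f' [cf' f'01 f'f] [eta eta0 sep]] :=
  perturb cX pT_eq eps'0 del2 cPhi Phi01 Phip Phi_dis Phi_cov wT mN cf f01 fu'.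
exists f', eta; split=> //.
  by move=> e x; have := f'f e x; lra.
move=> x y pxy xy; apply: le_trans (sep x y pxy xy) _.
have : eps' <= eps / 2 by rewrite ge_min lexx.
lra.
Qed.

Definition torus_height (x : X) : R := (\sum_i int_dist (repr (p x i))) / k%:R.

Lemma torus_height_continuous : continuous torus_height.
Proof.
move=> x; apply: cvgM; last exact: cvg_cst.
apply: (continuous_sum (f := fun i x => int_dist (repr (p x i)))) => i {}x.
by apply: coordinate_continuous => //; [exact: int_dist_continuous|exact: int_distDz].
Qed.

Lemma torus_height01 x : 0 <= torus_height x <= 1.
Proof.
rewrite /torus_height divr_ge0 ?sumr_ge0 //= => [|i _]; last exact: int_dist_ge0.
rewrite ler_pdivrMr ?ltr0n // mul1r -[k in k%:R]card_ord -sumr_const.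
by apply: ler_sum => i _; exact: int_dist_le1.
Qed.

(** Choose g so that all coordinates of p (T g x) are within s of 0.  The
    heights being equal, the coordinate i of p (T g y) is within k s of 0, so
    the coordinates i of p x and p y are at distance less than (k + 2) s, and
    s is chosen to make this impossible. *)
Lemma torus_height_separates x y :
  (forall g, torus_height (T g x) = torus_height (T g y)) -> p x = p y.
Proof.
move=> xy; apply/funext => i; apply: contrapT => pxy.
pose th j := repr (p x j); pose th' j := repr (p y j).
pose d := int_dist (th' i - th i).
have d0 : 0 < d.
  rewrite lt_neqAle int_dist_ge0 andbT eq_sym; apply/eqP => /int_dist_eq0.
  move=> /pi_circle_eq; rewrite /th /th' !reprK => /esym; exact: pxy.
pose s := d / k.+2%:R.
have s0 : 0 < s by rewrite divr_gt0 ?ltr0n.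
have /choice[n nP] : forall j, exists n : int, int_dist (th j + n%:~R * alpha j) < s.
  by move=> j; apply: orbit_dense.
pose g : 'rV[int]_k := \row_j n j.
have := xy g; rewrite /torus_height => /(mulIf _) E.
have {E} : \sum_j int_dist (th j + (n j)%:~R * alpha j) =
    \sum_j int_dist (th' j + (n j)%:~R * alpha j).
  transitivity (\sum_j int_dist (repr (p (T g x) j))).
    by apply: eq_bigr => j _; rewrite (coordinate_act pT) ?mxE //; exact: int_distDz.
  rewrite E ?invr_eq0 ?pnatr_eq0 -?lt0n //.
  by apply: eq_bigr => j _; rewrite (coordinate_act pT) ?mxE //; exact: int_distDz.
have : \sum_j int_dist (th j + (n j)%:~R * alpha j) <= k%:R * s.
  rewrite -[k in k%:R]card_ord mulr_natl -sumr_const.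
  by apply: ler_sum => j _; exact: ltW.
move=> le1 E; rewrite {}E (bigD1 i) //= in le1.
have rest : 0 <= \sum_(j < k | j != i) int_dist (th' j + (n j)%:~R * alpha j).
  by apply: sumr_ge0 => j _; exact: int_dist_ge0.
have := int_distB (th' i + (n i)%:~R * alpha i) (th i + (n i)%:~R * alpha i).
rewrite opprD addrACA subrr addr0 -/d => le2.
have ni := nP i.
have ds : d = k%:R * s + 2 * s.
  by rewrite -mulrDl -natrD addn2 /s mulrC divfK // pnatr_eq0.
clear pxy; lra.
Qed.

End assembly.

Theorem corollary1p1 (R : realType) (k L : nat) (hk : (1 <= k)%N)
    (hL : (1 <= L)%N) (X : metricType R) (cX : compact [set: X])
    (T : Zk_action k X)
    (hext : exists alpha : 'I_k -> R,
      (forall i, irrational (alpha i)) /\ is_extension T (rotation alpha))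
    (hmdim : (mdim T < (L%:R / 2)%:E)%E) :
  embeds T (full_shift R k (2 ^ k * L + 1)).
Proof.
have [alpha [ira [p [cp surj pT]]]] := hext.
have [x0 _ _] := surj (fun=> 0) I.
have [f [cf f01] finj] := separating_limit (separates_dense cX hk ira cp pT x0 hL hmdim).
apply: (embeds_full_shift (J := option ({ffun 'I_k -> bool} * 'I_L))
  (f := fun j => if j is Some e then f e else torus_height p)).
- by rewrite card_option card_prod card_ffun card_bool !card_ord addn1.
- case=> [e|]; [exact: cf | exact: (torus_height_continuous cp)].
- by case=> [e|] x; [exact: f01 | exact: torus_height01].
move=> x y xy; apply: finj => [|e g]; last exact: (xy (Some e) g).
by apply: (torus_height_separates hk ira pT) => g; exact: (xy None g).
Qed.
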